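(* Let $E$ be a Banach space. Then $\mathcal{A}(E)$ is super Arens regular if and only if $E$ is super-reflexive.
   Context: $\mathcal{A}(E)$ is the Banach algebra of approximable operators on $E$: the operator-norm closure in $\mathcal{B}(E)$ of the finite-rank bounded operators on $E$. For a Banach space $E$ and an ultrafilter $\mathcal{U}$ on a set $I$, the ultrapower is $(E)_{\mathcal{U}} = \ell^\infty(E,I)/\{(x_i)_{i\in I} : \lim_{i\to\mathcal{U}}\|x_i\|=0\}$, with norm $\|(x_i)\|=\lim_{i\to\mathcal{U}}\|x_i\|$. If $\mathcal{A}$ is a Banach algebra, $(\mathcal{A})_{\mathcal{U}}$ is a Banach algebra under the pointwise product. A Banach space $E$ is super-reflexive if $(E)_{\mathcal{U}}$ is reflexive for every ultrafilter $\mathcal{U}$. A Banach algebra is Arens regular if its first and second Arens products on the bidual coincide. $\mathcal{A}$ is super Arens regular if $(\mathcal{A})_{\mathcal{U}}$ is Arens regular for every ultrafilter $\mathcal{U}$. *)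

(* Defs.v *)
From HB Require Import structures.
From mathcomp Require Import all_boot all_order all_algebra.
From mathcomp Require Import generic_quotient.
From mathcomp Require Import all_classical all_reals all_analysis.
From mathcomp Require Import complex.

Set Implicit Arguments.
Unset Strict Implicit.
Unset Printing Implicit Defensive.

Import Order.TTheory GRing.Theory Num.Theory.
Import numFieldNormedType.Exports.

Local Open Scope classical_set_scope.
Local Open Scope ring_scope.

(* Banach spaces are taken over either of the two classical scalar fields. *)
Variant scalar_kind := RealScalars | ComplexScalars.

Definition scalar_field (R : realType) (k : scalar_kind) : numFieldType :=
  match k with
  | RealScalars => R
  | ComplexScalars => R[i]
  end.

Section Scalars.
Variables (R : realType) (k : scalar_kind).
Local Notation K := (scalar_field R k).

(* Norms live in the scalar field K (as nonnegative elements), so suprema of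
   norms have to be computed in R and transported back. *)
Definition sc_re : K -> R :=
  match k return scalar_field R k -> R with
  | RealScalars => id
  | ComplexScalars => @complex.Re R
  end.

Definition sc_inj : R -> K :=
  match k return R -> scalar_field R k with
  | RealScalars => id
  | ComplexScalars => fun x => Complex x 0
  end.

Lemma sc_injK : cancel sc_inj sc_re.
Proof. by rewrite /sc_inj /sc_re; case: k. Qed.

Lemma sc_reK (x : K) : 0 <= x -> sc_inj (sc_re x) = x.
Proof.
rewrite /sc_inj /sc_re; case: k x => //= -[a b].
by rewrite lecE /= => /andP[/eqP -> _].
Qed.

Lemma sc_inj_le (x y : R) : (sc_inj x <= sc_inj y) = (x <= y).
Proof. by rewrite /sc_inj; case: k => //; exact: lecR. Qed.

Lemma sc_inj_lt (x y : R) : (sc_inj x < sc_inj y) = (x < y).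
Proof. by rewrite /sc_inj; case: k => //; exact: ltcR. Qed.

Lemma sc_inj0 : sc_inj 0 = 0.
Proof. by rewrite /sc_inj; case: k. Qed.

Lemma sc_injB (x y : R) : sc_inj (x - y) = sc_inj x - sc_inj y.
Proof.
rewrite /sc_inj; case: k => //=; apply/eqP.
by rewrite eq_complex /= subr0 !eqxx.
Qed.

Lemma sc_injD (x y : R) : sc_inj (x + y) = sc_inj x + sc_inj y.
Proof.
rewrite /sc_inj; case: k => //=; apply/eqP.
by rewrite eq_complex /= addr0 !eqxx.
Qed.

Lemma sc_injM (x y : R) : sc_inj (x * y) = sc_inj x * sc_inj y.
Proof.
rewrite /sc_inj; case: k => //=; apply/eqP.
by rewrite eq_complex /= !(mul0r, mulr0, subr0, addr0) !eqxx.
Qed.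

Lemma sc_inj_norm (x : R) : `|sc_inj x| = sc_inj `|x|.
Proof.
have [x0|x0] := leP 0 x; first by rewrite !ger0_norm// -sc_inj0 sc_inj_le.
rewrite !ltr0_norm// -?sc_inj0 ?sc_inj_lt//.
by rewrite -sub0r -[in RHS]sub0r sc_injB sc_inj0.
Qed.

Lemma sc_re_le (x y : K) : 0 <= x -> 0 <= y -> (sc_re x <= sc_re y) = (x <= y).
Proof. by move=> x0 y0; rewrite -sc_inj_le !sc_reK. Qed.

Lemma sc_re_ge0 (x : K) : 0 <= x -> 0 <= sc_re x.
Proof. by move=> x0; rewrite -sc_inj_le sc_inj0 sc_reK. Qed.

Lemma sc_inj_continuous : continuous sc_inj.
Proof.
move=> x; apply/cvgrPdist_lt => e e0; have e0' := ltW e0.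
near=> y; rewrite -sc_injB sc_inj_norm -(sc_reK e0') sc_inj_lt.
near: y; apply: cvgr_dist_lt => //.
by rewrite -sc_inj_lt sc_inj0 sc_reK.
Unshelve. all: by end_near. Qed.

End Scalars.

(* Bounded operators with the operator norm: the space B(V, W). *)
Section BoundedOperators.
Variables (R : realType) (k : scalar_kind).
Local Notation K := (scalar_field R k).
Variables V W : normedModType K.

Definition bounded_linear : {pred V -> W} :=
  fun f => `[< linear f /\ exists M : K, forall x, `|f x| <= M * `|x| >].

Lemma bounded_linear_submod : submod_closed bounded_linear.
Proof.
split.
  apply/asboolP; split; first by move=> a x y /=; rewrite scaler0 addr0.
  by exists 0 => x; rewrite mul0r normr0.
move=> a f g /asboolP[fl [M fM]] /asboolP[gl [N gN]]; apply/asboolP; split.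
  move=> b x y; rewrite !fctE fl gl !scalerDr !scalerA (mulrC b).
  by rewrite -!addrA; congr (_ + _); rewrite addrCA.
exists (`|a| * M + N) => x; rewrite !fctE mulrDl.
rewrite (le_trans (ler_normD _ _))// lerD// normrZ -mulrA.
by rewrite ler_wpM2l.
Qed.

HB.instance Definition _ :=
  GRing.isSubmodClosed.Build K (V -> W) bounded_linear bounded_linear_submod.

Record bop := BOp { bop_fun :> V -> W; _ : bounded_linear bop_fun }.

HB.instance Definition _ := [isSub for bop_fun].
HB.instance Definition _ := [Choice of bop by <:].
HB.instance Definition _ := [SubChoice_isSubLmodule of bop by <:].

Lemma bopP (f g : bop) : (forall x, f x = g x) -> f = g.
Proof. by move=> fg; apply/val_inj/funext. Qed.

Lemma bop_linear (f : bop) : linear f.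
Proof. by case: f => f /= /asboolP[]. Qed.

HB.instance Definition _ (f : bop) :=
  GRing.isLinear.Build K V W *:%R f (bop_linear f).

Lemma bop_bounded (f : bop) : exists M : K, forall x, `|f x| <= M * `|x|.
Proof. by case: f => f /= /asboolP[]. Qed.

Lemma bopD (f g : bop) x : (f + g) x = f x + g x. Proof. by []. Qed.
Lemma bopB (f g : bop) x : (f - g) x = f x - g x. Proof. by []. Qed.
Lemma bopZ a (f : bop) x : (a *: f) x = a *: f x. Proof. by []. Qed.
Lemma bop0 x : (0 : bop) x = 0. Proof. by []. Qed.

Definition mk_bop (f : V -> W) (M : K) (fl : linear f)
    (fM : forall x, `|f x| <= M * `|x|) : bop :=
  BOp (asboolT (conj fl (ex_intro _ M fM))).

Lemma bop_bounded0 (f : bop) :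
  exists2 M : K, 0 <= M & forall x, `|f x| <= M * `|x|.
Proof.
have [M fM] := bop_bounded f.
have [[x x0]|V0] := pselect (exists x : V, x != 0).
  exists M => //; have := le_trans (normr_ge0 _) (fM x).
  by rewrite pmulr_lge0// normr_gt0.
exists 0 => // x; have [->|x0] := eqVneq x 0.
  by rewrite linear0 !normr0 mulr0.
by exfalso; apply: V0; exists x.
Qed.

Definition opnorm (f : bop) : K :=
  sc_inj k (sup [set sc_re `|f x| | x in [set x | `|x| <= 1]]).

Lemma opnorm_has_sup (f : bop) :
  has_sup [set sc_re `|f x| | x in [set x | `|x| <= 1]].
Proof.
split; first by exists (sc_re `|f 0|), 0 => //=; rewrite normr0.
have [M M0 fM] := bop_bounded0 f.
exists (sc_re M) => _ [y /= yle1 <-]; rewrite sc_re_le//.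
by rewrite (le_trans (fM y))// ler_piMr.
Qed.

Lemma opnorm_ub1 (f : bop) x : `|x| <= 1 -> `|f x| <= opnorm f.
Proof.
move=> x1; rewrite -[leLHS]sc_reK// /opnorm sc_inj_le; apply: ub_le_sup.
  exact: (opnorm_has_sup f).2.
by exists x.
Qed.

Lemma opnorm_ub (f : bop) x : `|f x| <= opnorm f * `|x|.
Proof.
have [->|x0] := eqVneq x 0; first by rewrite linear0 !normr0 mulr0.
have nx0 : 0 < `|x| by rewrite normr_gt0.
rewrite -ler_pdivrMr// mulrC.
have -> : `|x|^-1 * `|f x| = `|f (`|x|^-1 *: x)|.
  by rewrite linearZ normrZ ger0_norm// invr_ge0.
by apply: opnorm_ub1; rewrite normrZ ger0_norm ?invr_ge0// mulVf ?gt_eqF.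
Qed.

Lemma opnorm_ge0 (f : bop) : 0 <= opnorm f.
Proof.
apply: (le_trans (normr_ge0 (f 0))); apply: opnorm_ub1.
by rewrite normr0.
Qed.

Lemma opnorm_le (f : bop) (M : K) : 0 <= M ->
  (forall x, `|f x| <= M * `|x|) -> opnorm f <= M.
Proof.
move=> M0 fM; rewrite -(sc_reK M0) sc_inj_le; apply: ge_sup.
  exact: (opnorm_has_sup f).1.
move=> _ [y /= yle1 <-]; rewrite sc_re_le//.
by rewrite (le_trans (fM y))// ler_piMr.
Qed.

Lemma opnormD (f g : bop) : opnorm (f + g) <= opnorm f + opnorm g.
Proof.
apply: opnorm_le => [|x]; first by rewrite addr_ge0// opnorm_ge0.
by rewrite bopD (le_trans (ler_normD _ _))// mulrDl lerD// opnorm_ub.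
Qed.

Lemma opnormZ_le a (f : bop) : opnorm (a *: f) <= `|a| * opnorm f.
Proof.
apply: opnorm_le => [|x]; first by rewrite mulr_ge0// opnorm_ge0.
by rewrite bopZ normrZ -mulrA ler_wpM2l// opnorm_ub.
Qed.

Lemma opnormZ a (f : bop) : opnorm (a *: f) = `|a| * opnorm f.
Proof.
apply/le_anti; rewrite opnormZ_le /=.
have [->|a0] := eqVneq a 0; first by rewrite normr0 mul0r opnorm_ge0.
rewrite mulrC -ler_pdivlMr ?normr_gt0// mulrC -normfV.
by rewrite -[in leLHS](scalerK a0 f) opnormZ_le.
Qed.

Lemma opnorm_eq0 (f : bop) : opnorm f = 0 -> f = 0.
Proof.
move=> f0; apply: bopP => x; apply/eqP; rewrite -normr_le0.
by rewrite (le_trans (opnorm_ub f x))// f0 mul0r.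
Qed.

HB.instance Definition _ :=
  Lmodule_isNormed.Build K bop opnormD opnormZ opnorm_eq0.

Lemma bop_normE (f : bop) : `|f| = opnorm f. Proof. by []. Qed.

Lemma bop_ub (f : bop) x : `|f x| <= `|f| * `|x|.
Proof. exact: opnorm_ub. Qed.

Lemma bop_le (f : bop) (M : K) : 0 <= M ->
  (forall x, `|f x| <= M * `|x|) -> `|f| <= M.
Proof. exact: opnorm_le. Qed.

End BoundedOperators.

Section DualReflexive.
Variables (R : realType) (k : scalar_kind).
Local Notation K := (scalar_field R k).

Definition dual (V : normedModType K) : normedModType K := bop V K^o.

Variable V : normedModType K.

Definition evalb (x : V) (f : dual V) : K^o := (f : bop V K^o) x.

Lemma evalb_linear x : linear (evalb x). Proof. by []. Qed.

Lemma evalb_bounded x f : `|evalb x f| <= `|x| * `|f|.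
Proof. by rewrite mulrC; exact: bop_ub. Qed.

Definition to_bidual (x : V) : dual (dual V) :=
  mk_bop (evalb_linear x) (evalb_bounded x).

Definition reflexive_space := forall Phi : dual (dual V),
  exists x : V, to_bidual x = Phi.

End DualReflexive.

(* Completeness plays no role in the definitions below, so it is not part of
   the structure; multiplication is not required to have a unit. *)
Record normedAlg (K : numFieldType) := NormedAlg {
  nalg_space :> normedModType K;
  nalg_mul : nalg_space -> nalg_space -> nalg_space;
  nalg_mulA : associative nalg_mul;
  nalg_mul_linear_l : forall b, linear (nalg_mul^~ b);
  nalg_mul_linear_r : forall a, linear (nalg_mul a);
  nalg_normM : forall a b, `|nalg_mul a b| <= `|a| * `|b| }.

Section Arens.
Variables (R : realType) (k : scalar_kind).
Local Notation K := (scalar_field R k).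
Variable A : normedAlg K.
Local Notation "a ** b" := (nalg_mul a b) (at level 40).
Implicit Types (a b : A) (f : dual A) (Phi Psi : dual (dual A)).

(* (f . a)(b) = f (a b) *)
Definition rmodf f a b : K^o := (f : bop A K^o) (a ** b).

Lemma rmodf_linear f a : linear (rmodf f a).
Proof. by move=> c x y; rewrite /rmodf nalg_mul_linear_r linearP. Qed.

Lemma rmodf_bounded f a b : `|rmodf f a b| <= `|f| * `|a| * `|b|.
Proof. by rewrite (le_trans (bop_ub _ _))// -mulrA ler_wpM2l// nalg_normM. Qed.

Definition rmod f a : dual A := mk_bop (rmodf_linear f a) (rmodf_bounded f a).

(* (a . f)(b) = f (b a) *)
Definition lmodf a f b : K^o := (f : bop A K^o) (b ** a).

Lemma lmodf_linear a f : linear (lmodf a f).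
Proof. by move=> c x y; rewrite /lmodf nalg_mul_linear_l linearP. Qed.

Lemma lmodf_bounded a f b : `|lmodf a f b| <= `|f| * `|a| * `|b|.
Proof.
rewrite (le_trans (bop_ub _ _))// -mulrA ler_wpM2l// (mulrC `|a|).
exact: nalg_normM.
Qed.

Definition lmod a f : dual A := mk_bop (lmodf_linear a f) (lmodf_bounded a f).

Lemma rmod_le f a : `|rmod f a| <= `|f| * `|a|.
Proof. by apply: bop_le; [rewrite mulr_ge0|exact: rmodf_bounded]. Qed.

Lemma lmod_le a f : `|lmod a f| <= `|f| * `|a|.
Proof. by apply: bop_le; [rewrite mulr_ge0|exact: lmodf_bounded]. Qed.

Lemma rmod_linear_l a : linear (rmod^~ a).
Proof. by move=> c f g; apply: bopP. Qed.

Lemma rmod_linear_r f : linear (rmod f).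
Proof.
move=> c a b; apply: bopP => x /=.
by rewrite /rmodf nalg_mul_linear_l linearP.
Qed.

Lemma lmod_linear_r a : linear (lmod a).
Proof. by move=> c f g; apply: bopP. Qed.

Lemma lmod_linear_l f : linear (lmod^~ f).
Proof.
move=> c a b; apply: bopP => x /=.
by rewrite /lmodf nalg_mul_linear_r linearP.
Qed.

(* (Phi . f)(a) = Phi (f . a) *)
Definition bilmodf Phi f a : K^o := (Phi : bop (dual A) K^o) (rmod f a).

Lemma bilmodf_linear Phi f : linear (bilmodf Phi f).
Proof. by move=> c x y; rewrite /bilmodf rmod_linear_r linearP. Qed.

Lemma bilmodf_bounded Phi f a : `|bilmodf Phi f a| <= `|Phi| * `|f| * `|a|.
Proof. by rewrite (le_trans (bop_ub _ _))// -mulrA ler_wpM2l// rmod_le. Qed.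

Definition bilmod Phi f : dual A :=
  mk_bop (bilmodf_linear Phi f) (bilmodf_bounded Phi f).

(* (f . Phi)(a) = Phi (a . f) *)
Definition birmodf f Phi a : K^o := (Phi : bop (dual A) K^o) (lmod a f).

Lemma birmodf_linear f Phi : linear (birmodf f Phi).
Proof. by move=> c x y; rewrite /birmodf lmod_linear_l linearP. Qed.

Lemma birmodf_bounded f Phi a : `|birmodf f Phi a| <= `|Phi| * `|f| * `|a|.
Proof. by rewrite (le_trans (bop_ub _ _))// -mulrA ler_wpM2l// lmod_le. Qed.

Definition birmod f Phi : dual A :=
  mk_bop (birmodf_linear f Phi) (birmodf_bounded f Phi).

Lemma bilmod_le Phi f : `|bilmod Phi f| <= `|Phi| * `|f|.
Proof. by apply: bop_le; [rewrite mulr_ge0|exact: bilmodf_bounded]. Qed.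

Lemma birmod_le f Phi : `|birmod f Phi| <= `|Phi| * `|f|.
Proof. by apply: bop_le; [rewrite mulr_ge0|exact: birmodf_bounded]. Qed.

Lemma bilmod_linear Phi : linear (bilmod Phi).
Proof.
move=> c f g; apply: bopP => a /=.
by rewrite /bilmodf rmod_linear_l linearP.
Qed.

Lemma birmod_linear Phi : linear (birmod^~ Phi).
Proof.
move=> c f g; apply: bopP => a /=.
by rewrite /birmodf lmod_linear_r linearP.
Qed.

Definition arens1f Phi Psi f : K^o := (Phi : bop (dual A) K^o) (bilmod Psi f).

Lemma arens1f_linear Phi Psi : linear (arens1f Phi Psi).
Proof. by move=> c x y; rewrite /arens1f bilmod_linear linearP. Qed.

Lemma arens1f_bounded Phi Psi f : `|arens1f Phi Psi f| <= `|Phi| * `|Psi| * `|f|.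
Proof. by rewrite (le_trans (bop_ub _ _))// -mulrA ler_wpM2l// bilmod_le. Qed.

Definition arens1 Phi Psi : dual (dual A) :=
  mk_bop (arens1f_linear Phi Psi) (arens1f_bounded Phi Psi).

Definition arens2f Phi Psi f : K^o := (Psi : bop (dual A) K^o) (birmod f Phi).

Lemma arens2f_linear Phi Psi : linear (arens2f Phi Psi).
Proof. by move=> c x y; rewrite /arens2f birmod_linear linearP. Qed.

Lemma arens2f_bounded Phi Psi f : `|arens2f Phi Psi f| <= `|Psi| * `|Phi| * `|f|.
Proof. by rewrite (le_trans (bop_ub _ _))// -mulrA ler_wpM2l// birmod_le. Qed.

Definition arens2 Phi Psi : dual (dual A) :=
  mk_bop (arens2f_linear Phi Psi) (arens2f_bounded Phi Psi).

Definition arens_regular := forall Phi Psi, arens1 Phi Psi = arens2 Phi Psi.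

End Arens.

Section Approximable.
Variables (R : realType) (k : scalar_kind).
Local Notation K := (scalar_field R k).
Variable E : normedModType K.
Local Notation B := (bop E E).

Definition bcompf (S T : B) : E -> E := S \o T.

Lemma bcompf_linear S T : linear (bcompf S T).
Proof. by move=> a x y; rewrite /bcompf /= !linearP. Qed.

Lemma bcompf_bounded (S T : B) x : `|bcompf S T x| <= `|S| * `|T| * `|x|.
Proof.
rewrite (le_trans (bop_ub _ _))// -mulrA ler_wpM2l//.
exact: bop_ub.
Qed.

Definition bcomp (S T : B) : B := mk_bop (bcompf_linear S T) (bcompf_bounded S T).

Lemma bcomp_norm S T : `|bcomp S T| <= `|S| * `|T|.
Proof. by apply: bop_le; [rewrite mulr_ge0|exact: bcompf_bounded]. Qed.

Definition finite_rank : set B := [set T |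
  exists (n : nat) (v : 'I_n -> E), forall x, exists c : 'I_n -> K,
    T x = \sum_(i < n) c i *: v i].

Definition approximable : {pred B} := fun T => `[< closure finite_rank T >].

Lemma finite_rank0 : finite_rank 0.
Proof.
exists 0%N, (fun=> 0) => x; exists (fun=> 0).
by rewrite bop0 big_ord0.
Qed.

Lemma finite_rankP a (S T : B) :
  finite_rank S -> finite_rank T -> finite_rank (a *: S + T).
Proof.
move=> [n [v Sv]] [m [w Tw]].
exists (n + m)%N,
  (fun i => match fintype.split i with inl j => v j | inr j => w j end) => x.
have [c Sx] := Sv x; have [d Tx] := Tw x.
exists (fun i => match fintype.split i with
                 | inl j => a * c j | inr j => d j end).
rewrite bopD bopZ Sx Tx big_split_ord /= scaler_sumr; congr (_ + _).
  apply: eq_bigr => i _.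
  by rewrite -[lshift m i]/(unsplit (inl i)) unsplitK scalerA.
apply: eq_bigr => i _.
by rewrite -[rshift n i]/(unsplit (inr i)) unsplitK.
Qed.

Lemma finite_rank_comp (S T : B) : finite_rank T -> finite_rank (bcomp S T).
Proof.
move=> [n [v Tv]]; exists n, (S \o v) => x.
have [c Tx] := Tv x; exists c.
rewrite /= /bcompf /= Tx linear_sum; apply: eq_bigr => i _.
by rewrite linearZ.
Qed.

Lemma approximableP (T : B) : T \in approximable <->
  forall e : K, 0 < e -> exists2 S, finite_rank S & `|T - S| < e.
Proof.
split=> [/asboolP Tc e e0|Tc].
  have [S [FS TS]] := Tc _ (nbhsx_ballx T e e0).
  by exists S => //; move: TS; rewrite -ball_normE.
apply/asboolP => N /nbhs_ballP[e /= e0 eN].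
have [S FS TS] := Tc e e0; exists S; split => //; apply: eN.
by rewrite -ball_normE.
Qed.

Lemma approximable_submod : submod_closed approximable.
Proof.
split.
  by apply/approximableP => e e0; exists 0; [exact: finite_rank0|
    rewrite subrr normr0].
move=> a S T /approximableP SA /approximableP TA; apply/approximableP => e e0.
have a0 : 0 < `|a| + 1 by rewrite ltr_wpDl.
have [S' FS' SS'] := SA (e / 2 / (`|a| + 1)) ltac:(by rewrite !divr_gt0).
have [T' FT' TT'] := TA (e / 2) ltac:(by rewrite divr_gt0).
exists (a *: S' + T'); first exact: finite_rankP.
rewrite opprD addrACA -scalerBr (le_lt_trans (ler_normD _ _))//.
rewrite [ltRHS](splitr e) ler_ltD// normrZ.
rewrite (le_trans (ler_wpM2l _ (ltW SS')))//.
by rewrite mulrA ler_pdivrMr// mulrC ler_wpM2l ?lerDl// divr_ge0// ltW.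
Qed.

HB.instance Definition _ :=
  GRing.isSubmodClosed.Build K B approximable approximable_submod.

(* The underlying space of A(E), with the operator norm. *)
Record approx_op := ApproxOp { approx_bop :> B; _ : approximable approx_bop }.

HB.instance Definition _ := [isSub for approx_bop].
HB.instance Definition _ := [Choice of approx_op by <:].
HB.instance Definition _ := [SubChoice_isSubLmodule of approx_op by <:].

Definition approx_norm (T : approx_op) : K := `|approx_bop T|.

Lemma approx_normD S T : approx_norm (S + T) <= approx_norm S + approx_norm T.
Proof. exact: ler_normD. Qed.

Lemma approx_normZ a T : approx_norm (a *: T) = `|a| * approx_norm T.
Proof. exact: normrZ. Qed.

Lemma approx_norm_eq0 T : approx_norm T = 0 -> T = 0.
Proof. by move=> /normr0_eq0 T0; exact: val_inj. Qed.

HB.instance Definition _ :=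
  Lmodule_isNormed.Build K approx_op approx_normD approx_normZ approx_norm_eq0.

Lemma bcomp_approximable (S T : approx_op) : approximable (bcomp S T).
Proof.
apply/approximableP => e e0.
have /approximableP TA : approx_bop T \in approximable by exact: (valP T).
have S0 : 0 < `|approx_bop S| + 1 by rewrite ltr_wpDl.
have [T' FT' TT'] := TA (e / (`|approx_bop S| + 1)) ltac:(by rewrite divr_gt0).
exists (bcomp S T'); first exact: finite_rank_comp.
have -> : bcomp S T - bcomp S T' = bcomp S (approx_bop T - T').
  by apply: bopP => x; exact/esym/(linearB (approx_bop S)).
rewrite (le_lt_trans (bcomp_norm _ _))//.
rewrite ltr_pdivlMr// in TT'; apply: le_lt_trans TT'.
by rewrite mulrC ler_wpM2l// lerDl.
Qed.

Definition approx_mul (S T : approx_op) : approx_op :=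
  ApproxOp (bcomp_approximable S T).

Lemma approx_mulA : associative approx_mul.
Proof. by move=> S T U; apply/val_inj/bopP. Qed.

Lemma approx_mul_linear_l T : linear (approx_mul^~ T).
Proof. by move=> a S S'; apply/val_inj/bopP. Qed.

Lemma bcomp_linear_r (S : B) : linear (bcomp S).
Proof. by move=> a T T'; apply: bopP => x; exact: bop_linear. Qed.

Lemma approx_mul_linear_r S : linear (approx_mul S).
Proof. by move=> a T T'; apply: val_inj; exact: bcomp_linear_r. Qed.

Lemma approx_normM S T : `|approx_mul S T| <= `|S| * `|T|.
Proof. exact: bcomp_norm. Qed.

Definition approx_alg : normedAlg K :=
  NormedAlg approx_mulA approx_mul_linear_l approx_mul_linear_r approx_normM.

End Approximable.

Section LInfinity.
Variables (K : numFieldType) (V : normedModType K) (I : Type).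

Definition bounded_family : {pred I -> V} :=
  fun x => `[< exists M : K, forall i, `|x i| <= M >].

Lemma bounded_familyP (x : I -> V) :
  reflect (exists M : K, forall i, `|x i| <= M) (x \in bounded_family).
Proof. exact: asboolP. Qed.

Lemma bounded_family_submod : submod_closed bounded_family.
Proof.
split; first by apply/bounded_familyP; exists 0 => i; rewrite normr0.
move=> a x y /bounded_familyP[M xM] /bounded_familyP[N yN].
apply/bounded_familyP; exists (`|a| * M + N) => i.
by rewrite (le_trans (ler_normD _ _))// lerD// normrZ ler_wpM2l.
Qed.

HB.instance Definition _ :=
  GRing.isSubmodClosed.Build K (I -> V) bounded_family bounded_family_submod.

(* The underlying vector space of l^infty(V, I). *)
Record linf := LInf { linf_fun :> I -> V; _ : bounded_family linf_fun }.

HB.instance Definition _ := [isSub for linf_fun].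
HB.instance Definition _ := [Choice of linf by <:].
HB.instance Definition _ := [SubChoice_isSubLmodule of linf by <:].

Lemma linfP (x : linf) : exists M : K, forall i, `|x i| <= M.
Proof. by apply/bounded_familyP; exact: (valP x). Qed.

Lemma linf_eq (x y : linf) : (forall i, x i = y i) -> x = y.
Proof. by move=> xy; apply/val_inj/funext. Qed.

Definition mk_linf (x : I -> V) (M : K) (xM : forall i, `|x i| <= M) : linf :=
  LInf (introT (bounded_familyP x) (ex_intro _ M xM)).

End LInfinity.

Lemma cvgr_le_to (R : realType) (I : Type) (F : set_system I)
    {FF : ProperFilter F} (f g : I -> R) (a b : R) :
  f @ F --> a -> g @ F --> b -> (forall i, f i <= g i) -> a <= b.
Proof.
move=> fa gb fg; rewrite -subr_ge0; apply: (cvgr_to_ge (cvgB gb fa)).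
by apply: filterE => i; rewrite subr_ge0.
Qed.

Section UltraLimit.
Variables (R : realType) (k : scalar_kind).
Local Notation K := (scalar_field R k).
Variables (V : normedModType K) (I : Type) (U : set_system I).

Definition ulim (x : linf V I) : K := lim (`|x i| @[i --> U]).

(* lim_(i -> U) |x i| = 0 *)
Definition unull (x : linf V I) : Prop := `|x i| @[i --> U] --> (0 : K).

Context {UU : UltraFilter U}.

Definition ulimr (x : linf V I) : R := lim (sc_re `|x i| @[i --> U]).

Lemma ulimr_cvg (x : linf V I) : sc_re `|x i| @[i --> U] --> ulimr x.
Proof.
have [M xM] := linfP x.
suff [p pU] : exists p : R, sc_re `|x i| @[i --> U] --> p.
  by apply/cvg_ex; exists p.
have /(_ (sc_re `|x i| @[i --> U])) := @segment_compact R 0 (sc_re M).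
case=> [|p [_ clp]].
  apply: (@filterS _ U _ setT) => [i _|]; last exact: filterT.
  rewrite /= in_itv /= sc_re_ge0//= sc_re_le//.
  exact: le_trans (xM i).
exists p => B Bp /=.
have [//|UB] := in_ultra_setVsetC ((fun i => sc_re `|x i|) @^-1` B) UU.
have : (sc_re `|x i| @[i --> U]) (~` B) by [].
by move=> /clp /(_ Bp) [y []].
Qed.

Lemma ulim_cvgE (x : linf V I) : `|x i| @[i --> U] --> sc_inj k (ulimr x).
Proof.
have -> : (fun i => `|x i|) = (fun i => sc_inj k (sc_re `|x i|)).
  by apply/funext => i; rewrite sc_reK.
apply: (@cvg_comp _ _ _ (fun i => sc_re `|x i|) (sc_inj k)).
  exact: ulimr_cvg.
exact: sc_inj_continuous.
Qed.

Lemma ulimE (x : linf V I) : ulim x = sc_inj k (ulimr x).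
Proof. by apply: cvg_lim; [exact: norm_hausdorff|exact: ulim_cvgE]. Qed.

Lemma ulim_cvg (x : linf V I) : `|x i| @[i --> U] --> ulim x.
Proof. by rewrite ulimE; exact: ulim_cvgE. Qed.

Lemma ulim_eq (x : linf V I) l : `|x i| @[i --> U] --> l -> ulim x = l.
Proof. by move=> xl; apply: cvg_lim => //; exact: norm_hausdorff. Qed.

Lemma unullP (x : linf V I) : unull x <-> ulim x = 0.
Proof.
split => [|x0]; first exact: ulim_eq.
by rewrite /unull -x0; exact: ulim_cvg.
Qed.

Lemma ulim_ge0 (x : linf V I) : 0 <= ulim x.
Proof.
rewrite ulimE -(sc_inj0 R k) sc_inj_le; apply: limr_ge.
  by apply/cvg_ex; exists (ulimr x); exact: ulimr_cvg.
by apply: filterE => i; exact: sc_re_ge0.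
Qed.

Lemma ulimD (x y : linf V I) : ulim (x + y) <= ulim x + ulim y.
Proof.
rewrite !ulimE -sc_injD sc_inj_le.
apply: (cvgr_le_to (@ulimr_cvg (x + y))
  (cvgD (@ulimr_cvg x) (@ulimr_cvg y))) => i /=.
rewrite -(@sc_inj_le R k) sc_injD !sc_reK//.
exact: ler_normD.
Qed.

Lemma ulimZ a (x : linf V I) : ulim (a *: x) = `|a| * ulim x.
Proof.
apply: ulim_eq.
have -> : (fun i => `|(a *: x : linf V I) i|) = (fun i => `|a| * `|x i|).
  by apply/funext => i; exact: normrZ.
by apply: cvgM; [exact: cvg_cst|exact: ulim_cvg].
Qed.

Lemma ulimN (x : linf V I) : ulim (- x) = ulim x.
Proof. by rewrite -scaleN1r ulimZ normrN1 mul1r. Qed.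

Lemma ulim0 : ulim 0 = 0.
Proof. by rewrite -(scale0r 0) ulimZ normr0 mul0r. Qed.

Lemma unull_eq (x y : linf V I) : unull (x - y) -> ulim x = ulim y.
Proof.
move=> /unullP xy0; apply/le_anti/andP; split.
  by rewrite -[leLHS](congr1 ulim (subrK y x)) (le_trans (ulimD _ _))// xy0 add0r.
rewrite -[leLHS](congr1 ulim (subrK x y)) (le_trans (ulimD _ _))//.
by rewrite -opprB ulimN xy0 add0r.
Qed.

End UltraLimit.

Lemma ulimM (R : realType) (k : scalar_kind)
    (V W X : normedModType (scalar_field R k)) (I : Type) (U : set_system I)
    (UU : UltraFilter U) (x : linf V I) (y : linf W I) (z : linf X I) :
  (forall i, `|z i| <= `|x i| * `|y i|) -> ulim U z <= ulim U x * ulim U y.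
Proof.
move=> zxy; rewrite !ulimE -sc_injM sc_inj_le.
apply: (cvgr_le_to (@ulimr_cvg _ _ _ _ _ _ z)
  (cvgM (@ulimr_cvg _ _ _ _ _ _ x) (@ulimr_cvg _ _ _ _ _ _ y))) => i /=.
by rewrite -(@sc_inj_le R k) sc_injM !sc_reK.
Qed.

Section Ultrapower.
Variables (R : realType) (k : scalar_kind).
Local Notation K := (scalar_field R k).
Variables (V : normedModType K) (I : Type) (U : set_system I).
Variable UU : UltraFilter U.

Definition ueq : rel (linf V I) := fun x y => `[< unull U (x - y) >].

Lemma ueq_refl : reflexive ueq.
Proof. by move=> x; apply/asboolP/unullP; rewrite subrr ulim0. Qed.

Lemma ueq_sym : symmetric ueq.
Proof.
by move=> x y; apply/asbool_equiv_eq; rewrite !unullP -[x - y]opprB ulimN.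
Qed.

Lemma ueq_trans : transitive ueq.
Proof.
move=> y x z /asboolP xy /asboolP /unullP yz; apply/asboolP/unullP.
rewrite -yz; apply: unull_eq.
by rewrite opprB addrA subrK.
Qed.

Definition ueq_equiv := EquivRel ueq ueq_refl ueq_sym ueq_trans.

(* (V)_U = l^infty(V, I) / {x | lim_(i -> U) |x i| = 0} *)
Definition ultrapower : Type := {eq_quot ueq_equiv}%qT.

HB.instance Definition _ := Choice.copy ultrapower {eq_quot ueq_equiv}%qT.

Definition ucls (x : linf V I) : ultrapower := \pi_({eq_quot ueq_equiv})%qT x.

Definition urepr (q : ultrapower) : linf V I := repr (q : {eq_quot ueq_equiv}%qT).

Lemma ureprK : cancel urepr ucls.
Proof. by move=> q; exact: reprK. Qed.

Lemma ucls_eq (x y : linf V I) : ucls x = ucls y <-> unull U (x - y).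
Proof.
split => [/(@eqmodP _ ueq_equiv)/asboolP//|xy].
by apply/(@eqmodP _ ueq_equiv)/asboolP.
Qed.

Lemma ucls_ind (P : ultrapower -> Prop) : (forall x, P (ucls x)) -> forall q, P q.
Proof. by move=> Px q; rewrite -(ureprK q). Qed.

Definition uadd (p q : ultrapower) := ucls (urepr p + urepr q).
Definition uopp (p : ultrapower) := ucls (- urepr p).
Definition uscale (a : K) (p : ultrapower) := ucls (a *: urepr p).
Definition unorm (p : ultrapower) : K := ulim U (urepr p).

Lemma urepr_null x : unull U (urepr (ucls x) - x).
Proof. by apply/ucls_eq; rewrite ureprK. Qed.

Lemma unullD (x y : linf V I) : unull U x -> unull U y -> unull U (x + y).
Proof.
move=> /unullP x0 /unullP y0; apply/unullP/le_anti.
by rewrite ulim_ge0 (le_trans (ulimD _ _))// x0 y0 addr0.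
Qed.

Lemma unullZ a (x : linf V I) : unull U x -> unull U (a *: x).
Proof. by move=> /unullP x0; apply/unullP; rewrite ulimZ x0 mulr0. Qed.

Lemma uaddE x y : uadd (ucls x) (ucls y) = ucls (x + y).
Proof.
apply/ucls_eq; rewrite opprD addrACA.
by apply: unullD; exact: urepr_null.
Qed.

Lemma uscaleE a x : uscale a (ucls x) = ucls (a *: x).
Proof.
by apply/ucls_eq; rewrite -scalerBr; apply: unullZ; exact: urepr_null.
Qed.

Lemma uoppE x : uopp (ucls x) = ucls (- x).
Proof.
by apply/ucls_eq; rewrite -opprD -scaleN1r; apply: unullZ; exact: urepr_null.
Qed.

Lemma unormE x : unorm (ucls x) = ulim U x.
Proof. by apply: unull_eq; exact: urepr_null. Qed.

Lemma uaddA : associative uadd.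
Proof.
elim/ucls_ind => x; elim/ucls_ind => y; elim/ucls_ind => z.
by rewrite !uaddE addrA.
Qed.

Lemma uaddC : commutative uadd.
Proof.
by elim/ucls_ind => x; elim/ucls_ind => y; rewrite !uaddE addrC.
Qed.

Lemma uadd0 : left_id (ucls 0) uadd.
Proof. by elim/ucls_ind => x; rewrite uaddE add0r. Qed.

Lemma uaddN : left_inverse (ucls 0) uopp uadd.
Proof. by elim/ucls_ind => x; rewrite uoppE uaddE addNr. Qed.

HB.instance Definition _ :=
  GRing.isZmodule.Build ultrapower uaddA uaddC uadd0 uaddN.

Lemma uscaleA a b p : uscale a (uscale b p) = uscale (a * b) p.
Proof. by elim/ucls_ind: p => x; rewrite !uscaleE scalerA. Qed.

Lemma uscale1 : left_id 1 uscale.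
Proof. by elim/ucls_ind => x; rewrite uscaleE scale1r. Qed.

Lemma uscaleDr : right_distributive uscale +%R.
Proof.
move=> a; elim/ucls_ind => x; elim/ucls_ind => y.
by rewrite /GRing.add /= uaddE !uscaleE uaddE scalerDr.
Qed.

Lemma uscaleDl p : {morph uscale^~ p : a b / a + b}.
Proof.
elim/ucls_ind: p => x a b.
by rewrite [RHS]/GRing.add /= !uscaleE uaddE scalerDl.
Qed.

HB.instance Definition _ := GRing.Zmodule_isLmodule.Build K ultrapower
  uscaleA uscale1 uscaleDr uscaleDl.

Lemma uclsD x y : ucls (x + y) = ucls x + ucls y.
Proof. exact/esym/uaddE. Qed.

Lemma uclsZ a x : ucls (a *: x) = a *: ucls x.
Proof. exact/esym/uscaleE. Qed.

Lemma unormD p q : unorm (p + q) <= unorm p + unorm q.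
Proof.
elim/ucls_ind: p => x; elim/ucls_ind: q => y.
by rewrite -uclsD !unormE ulimD.
Qed.

Lemma unormZ a p : unorm (a *: p) = `|a| * unorm p.
Proof. by elim/ucls_ind: p => x; rewrite -uclsZ !unormE ulimZ. Qed.

Lemma unorm_eq0 p : unorm p = 0 -> p = 0.
Proof.
elim/ucls_ind: p => x; rewrite unormE => /unullP x0.
by apply/ucls_eq; rewrite subr0.
Qed.

HB.instance Definition _ :=
  Lmodule_isNormed.Build K ultrapower unormD unormZ unorm_eq0.

Lemma ucls_norm x : `|ucls x| = ulim U x.
Proof. exact: unormE. Qed.

End Ultrapower.

Section UltrapowerAlgebra.
Variables (R : realType) (k : scalar_kind).
Local Notation K := (scalar_field R k).
Variables (A : normedAlg K) (I : Type) (U : set_system I).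
Variable UU : UltraFilter U.
Local Notation AU := (@ultrapower R k A I U UU).
Local Notation cls := (@ucls R k A I U UU).

Lemma lmul_bounded (x y : linf A I) :
  bounded_family (fun i => nalg_mul (x i) (y i)).
Proof.
have [M xM] := linfP x; have [N yN] := linfP y.
apply/bounded_familyP; exists (M * N) => i.
by rewrite (le_trans (nalg_normM _ _))// ler_pM.
Qed.

Definition lmul (x y : linf A I) : linf A I := LInf (lmul_bounded x y).

Lemma lmul_linear_l y : linear (lmul^~ y).
Proof. by move=> a x x'; apply: linf_eq => i; exact: nalg_mul_linear_l. Qed.

Lemma lmul_linear_r x : linear (lmul x).
Proof. by move=> a y y'; apply: linf_eq => i; exact: nalg_mul_linear_r. Qed.

Lemma lmulBl x x' y : lmul (x' - x) y = lmul x' y - lmul x y.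
Proof.
have := lmul_linear_l y (-1) x x'; rewrite !scaleN1r /= => e.
by rewrite addrC e addrC.
Qed.

Lemma lmulBr x y y' : lmul x (y' - y) = lmul x y' - lmul x y.
Proof.
have := lmul_linear_r x (-1) y y'; rewrite !scaleN1r => e.
by rewrite addrC e addrC.
Qed.

Lemma lmulA : associative lmul.
Proof. by move=> x y z; apply: linf_eq => i; exact: nalg_mulA. Qed.

Lemma ulim_lmul x y : ulim U (lmul x y) <= ulim U x * ulim U y.
Proof. by apply: ulimM => i; exact: nalg_normM. Qed.

(* Pointwise product of representatives. *)
Definition umul (p q : AU) : AU := cls (lmul (urepr p) (urepr q)).

Lemma umulE x y : umul (cls x) (cls y) = cls (lmul x y).
Proof.
apply/ucls_eq; set x' := urepr _; set y' := urepr _.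
have x0 : ulim U (x' - x) = 0 by apply/unullP; exact: urepr_null.
have y0 : ulim U (y' - y) = 0 by apply/unullP; exact: urepr_null.
have -> : lmul x' y' - lmul x y = lmul (x' - x) y' + lmul x (y' - y).
  by rewrite lmulBl lmulBr addrA subrK.
apply: unullD; apply/unullP/le_anti; rewrite ulim_ge0 andbT.
  by rewrite (le_trans (ulim_lmul _ _))// x0 mul0r.
by rewrite (le_trans (ulim_lmul _ _))// y0 mulr0.
Qed.

Lemma umulA : associative umul.
Proof.
elim/ucls_ind => x; elim/ucls_ind => y; elim/ucls_ind => z.
by rewrite !umulE lmulA.
Qed.

Lemma umul_linear_l q : linear (umul^~ q).
Proof.
move=> a; elim/ucls_ind: q => y; elim/ucls_ind => x; elim/ucls_ind => x'.
by rewrite -uclsZ -uclsD !umulE lmul_linear_l uclsD uclsZ.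
Qed.

Lemma umul_linear_r p : linear (umul p).
Proof.
move=> a; elim/ucls_ind: p => x; elim/ucls_ind => y; elim/ucls_ind => y'.
by rewrite -uclsZ -uclsD !umulE lmul_linear_r uclsD uclsZ.
Qed.

Lemma umul_norm p q : `|umul p q| <= `|p| * `|q|.
Proof.
elim/ucls_ind: p => x; elim/ucls_ind: q => y.
by rewrite umulE !ucls_norm ulim_lmul.
Qed.

Definition ultrapower_alg : normedAlg K :=
  NormedAlg umulA umul_linear_l umul_linear_r umul_norm.

End UltrapowerAlgebra.

Section Super.
Variables (R : realType) (k : scalar_kind).
Local Notation K := (scalar_field R k).

Definition super_reflexive (E : normedModType K) :=
  forall (I : Type) (U : set_system I) (UU : UltraFilter U),
    reflexive_space (@ultrapower R k E I U UU).

Definition super_arens_regular (A : normedAlg K) :=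
  forall (I : Type) (U : set_system I) (UU : UltraFilter U),
    arens_regular (ultrapower_alg A UU).

End Super.

(* Main.v *)
(* Both properties are equivalent to J-convexity of E: for some m and e > 0, any
   z_0, ..., z_(m-1) in the unit ball admit j with
     |z_0 + ... + z_j - z_(j+1) - ... - z_(m-1)| <= m - e.
   If E is not J-convex, norming functionals of such signed sums produce, in an
   ultrapower over nat, vectors x_i and functionals g_j with Re g_j(x_i) <= -1/2
   for i <= j and >= 1/2 for i > j.  These violate the interchange of iterated
   limits, hence reflexivity, and through the rank-one operators x0 (x) g_j and
   x_i (x) h also Arens regularity.
   Conversely J-convexity amounts to a quadratic inequality between norms, which
   passes to ultrapowers of E and to averages q(b) = Lambda(|b_i x|^2) for any
   positive functional Lambda on the bounded functions of (i, x).  Following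
   James, a quadratic form q with this inequality forces iterated limits to
   agree.  With q = |.|^2 this gives reflexivity.  For Arens regularity one
   dominates a functional f on the ultrapower of A(E) by a positive functional,
   Re f(c) <= Lambda(|c_i x|), so |a| and q(b) control Re f(ab). *)

Require Import Defs.
From mathcomp Require Import all_boot all_order all_algebra.
From mathcomp Require Import all_classical all_reals all_analysis.
From mathcomp Require Import complex lra ring zify.

Set Implicit Arguments.
Unset Strict Implicit.
Unset Printing Implicit Defensive.

Import Order.TTheory GRing.Theory Num.Theory.
Import numFieldNormedType.Exports.

Local Open Scope classical_set_scope.
Local Open Scope ring_scope.

(** * Real scalars and real parts in the field K *)

Section RealParts.
Variables (R : realType) (k : scalar_kind).
Local Notation K := (scalar_field R k).
Local Notation sc := (@sc_inj R k).
Local Notation re := (@sc_re R k).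

Lemma sc_inj1 : sc 1 = 1.
Proof. by rewrite /sc_inj; case: k. Qed.

Lemma sc_injN (x : R) : sc (- x) = - sc x.
Proof. by rewrite -[in LHS]sub0r sc_injB sc_inj0 sub0r. Qed.

Lemma sc_reD (x y : K) : re (x + y) = re x + re y.
Proof. by move: x y; rewrite /sc_re; case: k => //= -[a b] [c d]. Qed.

Lemma sc_reZ (r : R) (x : K) : re (sc r * x) = r * re x.
Proof.
move: x; rewrite /sc_re /sc_inj; case: k => //= -[a b] /=.
by rewrite mul0r subr0.
Qed.

Lemma sc_re_le_norm (x : K) : `|re x| <= re `|x|.
Proof.
move: x; rewrite /sc_re; case: k => //= x.
by have := normc_ge_Re x; rewrite lecE /= => /andP[].
Qed.

End RealParts.

(** * Sublinear functionals and the Hahn-Banach theorem *)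

Section Sublinear.
Variables (R : realType) (k : scalar_kind).
Local Notation K := (scalar_field R k).
Local Notation sc := (@sc_inj R k).
Variable V : lmodType K.
Implicit Types (p q u : V -> R) (x y : V).

(** Real-linear functionals on a space over [K]: all separation and limit arguments run on real
    parts, which treats both scalar fields at once; [complexify] returns to [K]. *)
Definition rlinear u :=
  (forall x y, u (x + y) = u x + u y) /\ forall r x, u (sc r *: x) = r * u x.

Definition sublinear p :=
  (forall x y, p (x + y) <= p x + p y) /\
  forall r x, 0 < r -> p (sc r *: x) = r * p x.

Lemma rlinear0 u : rlinear u -> u 0 = 0.
Proof. by case=> _ uZ; rewrite -(scale0r 0) -(sc_inj0 R k) uZ mul0r. Qed.

Lemma rlinearN u x : rlinear u -> u (- x) = - u x.
Proof. by case=> _ uZ; rewrite -scaleN1r -sc_inj1 -sc_injN uZ mulN1r. Qed.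

Lemma rlinearB u x y : rlinear u -> u (x - y) = u x - u y.
Proof. by move=> ul; rewrite (ul.1) rlinearN. Qed.

Lemma rlinear_sum u (I : Type) (r : seq I) (P : pred I) (F : I -> V) :
  rlinear u -> u (\sum_(i <- r | P i) F i) = \sum_(i <- r | P i) u (F i).
Proof.
by move=> ul; apply: big_morph => [x y|]; [rewrite ul.1|exact: rlinear0].
Qed.

Lemma sublinear0 p : sublinear p -> p 0 = 0.
Proof.
case=> _ /(_ 2 0); rewrite scaler0 => /(_ ltac:(lra)); lra.
Qed.

Section InfSublinear.
Variables (C : Type) (c0 : C) (F : C -> V -> R).
Hypothesis FD : forall c d x y, exists e, F e (x + y) <= F c x + F d y.
Hypothesis FZ : forall c (r : R) x, 0 < r ->
  exists e, F e (sc r *: x) <= r * F c x.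
Hypothesis F0 : forall c, 0 <= F c 0.

(** The common source of the sublinear functionals below: the family has to be subadditive and
    homogeneous only up to a change of index. It serves for tilts, for infima of chains, for the
    gauge in [goldstine], for the distance to a range and for [positive_domination]. *)
Definition infF x := inf [set F c x | c in setT].

Lemma has_infF x : has_inf [set F c x | c in setT].
Proof.
split; first by exists (F c0 x), c0.
exists (- F c0 (- x)) => _ [c _ <-]; have [e] := FD c c0 x (- x).
by rewrite subrr; have := F0 e; lra.
Qed.

Lemma infF_le c x : infF x <= F c x.
Proof. by apply: ge_inf; [exact: (has_infF x).2|exists c]. Qed.

Lemma infF_ge a x : (forall c, a <= F c x) -> a <= infF x.
Proof.
by move=> ax; apply: lb_le_inf; [exact: (has_infF x).1|move=> _ [c _ <-]].
Qed.

Lemma infF_lt (a : R) x : infF x < a -> exists c, F c x < a.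
Proof.
by move=> /(inf_lt (has_infF x).1) [_ [c _ <-] ca]; exists c.
Qed.

Let infFZ_le r x : 0 < r -> infF (sc r *: x) <= r * infF x.
Proof.
move=> r0; rewrite -ler_pdivrMl//; apply: infF_ge => c; rewrite ler_pdivrMl//.
by have [e] := FZ c x r0; apply: le_trans; exact: infF_le.
Qed.

Lemma infF_sublinear : sublinear infF.
Proof.
split=> [x y|r x r0].
  rewrite -lerBlDr; apply: infF_ge => c; rewrite lerBlDr -lerBlDl.
  apply: infF_ge => d; rewrite lerBlDl.
  by have [e] := FD c d x y; apply: le_trans; exact: infF_le.
apply/le_anti; rewrite infFZ_le//= -ler_pdivlMl//.
have /infFZ_le : 0 < r^-1 by rewrite invr_gt0.
move=> /(_ (sc r *: x)); apply: le_trans.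
by rewrite scalerA -sc_injM mulVf ?gt_eqF// sc_inj1 scale1r.
Qed.

End InfSublinear.

Section Tilt.
Variables (q : V -> R) (y : V).
Hypothesis qs : sublinear q.

Let F (t : {t : R | 0 <= t}) x := q (x + sc (val t) *: y) - val t * q y.
Let t0 : {t : R | 0 <= t} := exist _ 0 (lexx 0).

Let FD c d x z : exists e, F e (x + z) <= F c x + F d z.
Proof.
exists (exist (fun t => 0 <= t) (val c + val d) (addr_ge0 (valP c) (valP d))).
rewrite /F /= sc_injD scalerDl addrACA mulrDl.
by have := qs.1 (x + sc (val c) *: y) (z + sc (val d) *: y); lra.
Qed.

Let FZ c r x : 0 < r -> exists e, F e (sc r *: x) <= r * F c x.
Proof.
move=> r0.
exists (exist (fun t => 0 <= t) (r * val c) (mulr_ge0 (ltW r0) (valP c))).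
by rewrite /F /= sc_injM -scalerA -scalerDr qs.2// mulrBr mulrA.
Qed.

Let F0 c : 0 <= F c 0.
Proof.
case: c => c c0; rewrite /F /= add0r.
move: c0; rewrite le_eqVlt => /predU1P[<-|c0].
  by rewrite sc_inj0 scale0r sublinear0// mul0r subr0.
by rewrite qs.2// subrr.
Qed.

(** [q'] is the infimum over [t >= 0] of [q (x + t y) - t q y]. The value [t = 0] gives the first
    bound and [t = 1] the second. *)
Lemma tilt : exists2 q', sublinear q' &
  (forall x, q' x <= q x) /\ forall x, q' x <= q (x + y) - q y.
Proof.
exists (infF F); first exact: infF_sublinear.
split=> x.
  have := infF_le t0 FD F0 t0 x.
  by rewrite /F /= sc_inj0 scale0r addr0 mul0r subr0.
have := infF_le t0 FD F0 (exist (fun t => 0 <= t) 1 ler01) x.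
by rewrite /F /= sc_inj1 scale1r mul1r.
Qed.

End Tilt.

(* A minimal sublinear functional [q] is linear: [tilt q y] is again sublinear
   and below [q], hence equal to it. *)
Lemma minimal_sublinear p : sublinear p ->
  exists2 u, rlinear u & forall x, u x <= p x.
Proof.
move=> ps.
pose T := {q : V -> R | sublinear q /\ forall x, q x <= p x}.
(* The order is reversed, so that a maximal element for Zorn's lemma is a minimal functional. *)
pose le_T (s t : T) := `[< forall x, sval t x <= sval s x >].
have [||A Atot|[q [qs qp]] qmin] :=
  @ZL_preorder T (exist _ p (conj ps (fun=> lexx _))) le_T.
- by move=> t; apply/asboolP.
- move=> r s t /asboolP rs /asboolP st; apply/asboolP => x.
  exact: le_trans (st x) (rs x).
- have [[a0 Aa0]|A0] := pselect (exists a, A a); last first.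
    exists (exist _ p (conj ps (fun=> lexx _))) => s As.
    by exfalso; apply: A0; exists s.
  (* A nonempty chain is bounded by its pointwise infimum; of two members the smaller one witnesses
     joint subadditivity. *)
  pose C := {a : T | A a}; pose F (c : C) := sval (sval c).
  have FD (c d : C) x y : exists e, F e (x + y) <= F c x + F d y.
    have [/asboolP dc|/asboolP cd] := Atot _ _ (svalP c) (svalP d).
      exists d; have := dc x; have := (svalP (sval d)).1.1 x y.
      by rewrite /F; lra.
    exists c; have := cd y; have := (svalP (sval c)).1.1 x y.
    by rewrite /F; lra.
  have FZ (c : C) r x : 0 < r -> exists e, F e (sc r *: x) <= r * F c x.
    by move=> r0; exists c; rewrite /F (svalP (sval c)).1.2.
  have F0 (c : C) : 0 <= F c 0.
    by rewrite /F sublinear0//; exact: (svalP (sval c)).1.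
  pose c0 : C := exist _ a0 Aa0.
  have fs := infF_sublinear c0 FD FZ F0.
  have fp x : infF F x <= p x.
    exact: le_trans (infF_le c0 FD F0 c0 x) ((svalP a0).2 x).
  exists (exist _ (infF F) (conj fs fp)) => s As; apply/asboolP => x /=.
  exact: (infF_le c0 FD F0 (exist _ s As) x).
exists q; last exact: qp.
have qD x y : q (x + y) = q x + q y.
  apply/le_anti; rewrite qs.1 /=.
  have [q' q's [q'q q'y]] := tilt y qs.
  have q'p z : q' z <= p z := le_trans (q'q z) (qp z).
  have := qmin (exist _ q' (conj q's q'p)).
  by move=> /(_ (asboolT q'q)) /asboolP /(_ x) /=; have := q'y x; lra.
have qN x : q (- x) = - q x.
  by have := qD x (- x); rewrite subrr sublinear0//; lra.
split=> // r x; have [r0|r0|->] := ltgtP r 0.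
- rewrite -[r]opprK sc_injN scaleNr qN qs.2 ?oppr_gt0//; lra.
- exact: qs.2.
- by rewrite sc_inj0 scale0r sublinear0// mul0r.
Qed.

(** Any linear functional below the tilt of [p] at [x0] works: the tilt is at most [- p x0] at
    [- x0], which forces [p x0 <= u x0]. *)
Lemma hahn_banach p x0 : sublinear p ->
  exists u, [/\ rlinear u, forall x, u x <= p x & u x0 = p x0].
Proof.
move=> ps; have [q qs [qp qx0]] := tilt x0 ps.
have [u ul uq] := minimal_sublinear qs; exists u; split => // [x|].
  exact: le_trans (uq x) (qp x).
apply/le_anti; rewrite (le_trans (uq x0))//=.
have := qx0 (- x0); have := uq (- x0).
by rewrite rlinearN// addNr sublinear0//; lra.
Qed.

End Sublinear.

(** * Functionals and their real parts *)

Section RealNorm.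
Variables (R : realType) (k : scalar_kind).
Local Notation K := (scalar_field R k).
Local Notation sc := (@sc_inj R k).
Local Notation re := (@sc_re R k).

Definition rnorm (V : normedModType K) (x : V) : R := re `|x|.

Section Theory.
Variable V : normedModType K.
Implicit Types x y : V.

Lemma rnormK x : sc (rnorm x) = `|x|.
Proof. exact: sc_reK. Qed.

Lemma rnorm_ge0 x : 0 <= rnorm x.
Proof. exact: sc_re_ge0. Qed.

Lemma rnorm_le x (r : R) : (rnorm x <= r) = (`|x| <= sc r).
Proof. by rewrite -rnormK sc_inj_le. Qed.

Lemma rnorm_lt x (r : R) : (rnorm x < r) = (`|x| < sc r).
Proof. by rewrite -rnormK sc_inj_lt. Qed.

Lemma rnormD x y : rnorm (x + y) <= rnorm x + rnorm y.
Proof. by rewrite rnorm_le sc_injD !rnormK ler_normD. Qed.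

Lemma rnormM (a : K) x : rnorm (a *: x) = re `|a| * rnorm x.
Proof. by rewrite -sc_reZ sc_reK// /rnorm normrZ. Qed.

Lemma rnormZ (r : R) x : rnorm (sc r *: x) = `|r| * rnorm x.
Proof. by rewrite rnormM sc_inj_norm sc_injK. Qed.

Lemma rnormN x : rnorm (- x) = rnorm x.
Proof. by rewrite /rnorm normrN. Qed.

Lemma rnormB x y : rnorm (x - y) = rnorm (y - x).
Proof. by rewrite /rnorm distrC. Qed.

Lemma rnorm0 : rnorm (0 : V) = 0.
Proof. by rewrite /rnorm normr0 -(sc_inj0 R k) sc_injK. Qed.

Lemma rnorm0_eq0 x : rnorm x = 0 -> x = 0.
Proof.
by move=> x0; apply/eqP; rewrite -normr_eq0 -rnormK x0 sc_inj0.
Qed.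

Lemma rnorm_sublinear : sublinear (@rnorm V).
Proof.
by split=> [|r x r0]; [exact: rnormD|rewrite rnormZ gtr0_norm].
Qed.

Lemma rnorm_sum (I : Type) (r : seq I) (P : pred I) (F : I -> V) :
  rnorm (\sum_(i <- r | P i) F i) <= \sum_(i <- r | P i) rnorm (F i).
Proof.
elim/big_rec2 : _ => [|i y z _ zy]; first by rewrite rnorm0.
by rewrite (le_trans (rnormD _ _))// lerD2l.
Qed.

End Theory.

Section RealPart.
Variable V : normedModType K.
Implicit Types x y : V.

Definition rpart (f : dual V) x : R := re (evalb x f).

Lemma rpart_linear f : rlinear (rpart f).
Proof.
split=> [x y|r x]; rewrite /rpart /evalb.
  by rewrite linearD sc_reD.
by rewrite linearZ /= sc_reZ.
Qed.

Lemma rpart_le f x : `|rpart f x| <= rnorm f * rnorm x.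
Proof.
rewrite (le_trans (sc_re_le_norm _))// -(@sc_inj_le R k) sc_reK//.
rewrite sc_injM !rnormK; exact: bop_ub.
Qed.

Lemma rpartDf f g x : rpart (f + g) x = rpart f x + rpart g x.
Proof. exact: (sc_reD (evalb x f) (evalb x g)). Qed.

Lemma rpartZf r f x : rpart (sc r *: f) x = r * rpart f x.
Proof. exact: (sc_reZ r (evalb x f)). Qed.

Lemma rpart_linearf x : rlinear (rpart ^~ x).
Proof. by split=> *; [exact: rpartDf|exact: rpartZf]. Qed.

End RealPart.

Lemma unimodular (z : K) : exists2 c : K, `|c| = 1 & c * z = `|z|.
Proof.
have [->|z0] := eqVneq z 0; first by exists 1; rewrite ?normr1// mulr0 normr0.
exists (`|z| / z); last by rewrite mulfVK.
by rewrite normrM normrV ?unitfE// normr_id divff// normr_eq0.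
Qed.

(** Over the complex field the functional is [u x - i u (i x)]. *)
Lemma complexify (V : lmodType K) (u : V -> R) : rlinear u ->
  exists2 f : V -> K^o, linear f & forall x, re (f x) = u x.
Proof.
move: V u; rewrite /sc_re; case: k => V u ul.
  by exists u => // a x y; rewrite ul.1 ul.2.
exists (fun x => Complex (u x) (- u ((Complex 0 1 : R[i]) *: x))) => //.
have uC (a b : R) x :
    u (Complex a b *: x) = a * u x + b * u ((Complex 0 1 : R[i]) *: x).
  rewrite -!ul.2 -ul.1 /sc_inj scalerA -scalerDl; congr (u (_ *: _)).
  apply/eqP; rewrite eq_complex /=.
  by rewrite !(mul0r, mulr0, mulr1, subr0, addr0, add0r) !eqxx.
move=> [a b] x y; apply/eqP; rewrite eq_complex /= !ul.1 scalerDr ul.1 (uC a b).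
rewrite scalerA.
have -> : (Complex 0 1 : R[i]) * Complex a b = Complex (- b) a.
  by apply/eqP; rewrite eq_complex /= !(mul0r, mul1r, sub0r, add0r) !eqxx.
rewrite (uC (- b) a); apply/andP; split; apply/eqP; ring.
Qed.

Lemma dual_of_real (V : normedModType K) (u : V -> R) (M : R) : 0 <= M ->
  rlinear u -> (forall x, u x <= M * rnorm x) ->
  exists2 f : dual V, rnorm f <= M & forall x, rpart f x = u x.
Proof.
move=> M0 ul uM; have [f fl fu] := complexify ul.
(* Rotating [x] by a unimodular scalar makes the value of [f] equal to its modulus, hence to a value
   of [u]. *)
have f_bnd x : `|f x| <= sc M * `|x|.
  have [c c1 cx] := unimodular (f x).
  have cfx : f (c *: x) = `|f x|.
    have fN : f 0 = 0.
      by have := fl (-1) 0 0; rewrite scaler0 addr0 scaleN1r addNr.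
    by have := fl c x 0; rewrite fN !addr0 => ->; exact: cx.
  rewrite -cfx -[f _]sc_reK; last by rewrite cfx.
  rewrite fu -rnormK -sc_injM sc_inj_le (le_trans (uM _))//.
  by rewrite rnormM c1 -(sc_inj1 R k) sc_injK mul1r.
exists (mk_bop fl f_bnd); last by move=> x; exact: fu.
rewrite rnorm_le; apply: (@bop_le _ _ V K^o (mk_bop fl f_bnd) (sc M) _ f_bnd).
by rewrite -(sc_inj0 R k) sc_inj_le.
Qed.

Lemma dual_eq (V : normedModType K) (f g : dual V) :
  (forall x, rpart f x = rpart g x) -> f = g.
Proof.
move=> fg; pose h : bop V K^o := f - g.
have h0 x : rpart h x = 0.
  by rewrite (rlinearB f g (rpart_linearf x)) fg subrr.
apply/eqP; rewrite -subr_eq0; apply/eqP/bopP => x; rewrite -/h.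
have [c c1 cx] := unimodular (h x).
have hcx : h (c *: x) = `|h x| by rewrite linearZ; exact: cx.
apply/eqP; rewrite -normr_eq0 -hcx -[X in X == 0]sc_reK ?hcx//.
by rewrite -hcx [sc_re _]h0 sc_inj0.
Qed.

Lemma rnorm_dual_le (V : normedModType K) (f : dual V) (M : R) : 0 <= M ->
  (forall x, rpart f x <= M * rnorm x) -> rnorm f <= M.
Proof.
move=> M0 fM; have [g gM gf] := dual_of_real M0 (rpart_linear f) fM.
by rewrite (@dual_eq _ f g).
Qed.

Lemma norming_functional (V : normedModType K) (x : V) :
  exists2 f : dual V, rnorm f <= 1 & rpart f x = rnorm x.
Proof.
have [u [ul un ux]] := hahn_banach x (rnorm_sublinear V).
have [|f f1 fu] := dual_of_real ler01 ul; first by move=> y; rewrite mul1r.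
by exists f => //; rewrite fu.
Qed.

Lemma rnorm_to_bidual (V : normedModType K) (x : V) :
  rnorm (to_bidual x) = rnorm x.
Proof.
apply/le_anti/andP; split.
  apply: rnorm_dual_le => [|f]; first exact: rnorm_ge0.
  by rewrite (le_trans (ler_norm _))// mulrC; exact: (rpart_le f x).
have [f f1 <-] := norming_functional x.
rewrite -[rpart f x]/(rpart (to_bidual x) f) (le_trans (ler_norm _))//.
by rewrite (le_trans (rpart_le _ _))// ler_piMr// rnorm_ge0.
Qed.

End RealNorm.

(** * Ultrafilter limits and Goldstine's theorem *)

Section UltraLimits.
Variable R : realType.

(** The image of [U] is an ultrafilter containing a compact interval, and a cluster point of an
    ultrafilter is a limit. *)
Lemma ultra_cvg (I : Type) (U : set_system I) {UU : UltraFilter U}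
    (u : I -> R) (M : R) :
  (\forall i \near U, `|u i| <= M) -> exists l : R, u i @[i --> U] --> l.
Proof.
move=> uM; have /(_ (u i @[i --> U])) := @segment_compact R (- M) M.
case=> [|l [_ cl]].
  by apply: filterS uM => i; rewrite /= in_itv /= ler_norml.
exists l => B Bl /=; have [//|UB] := in_ultra_setVsetC (u @^-1` B) UU.
have : (u i @[i --> U]) (~` B) by [].
by move=> /cl /(_ Bl) [y []].
Qed.

Lemma cvg_ext (I : Type) (F : set_system I) (u v : I -> R) (l : R) :
  (forall i, u i = v i) -> u i @[i --> F] --> l -> v i @[i --> F] --> l.
Proof. by move=> /funext ->. Qed.

Lemma cvg_near_le (I : Type) (F : set_system I) {FF : Filter F}
    (u : I -> R) (l e : R) :
  0 < e -> u i @[i --> F] --> l -> \forall i \near F, `|u i - l| <= e.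
Proof.
move=> e0 /cvgrPdist_le /(_ e e0).
by apply: filterS => i; rewrite distrC.
Qed.

Lemma nat_ultrafilter : exists2 W : set_system nat, UltraFilter W & \oo `<=` W.
Proof. by have [W [WU sW]] := ultraFilterLemma eventually_filter; exists W. Qed.

End UltraLimits.

Section Goldstine.
Variables (R : realType) (k : scalar_kind).
Local Notation K := (scalar_field R k).
Local Notation sc := (@sc_inj R k).
Variables (V : normedModType K) (G : dual V -> R) (M N : R).
Hypotheses (Glin : rlinear G) (GM : forall f, G f <= M * rnorm f).
Hypotheses (M0 : 0 <= M) (MN : M < N).

(** Hahn-Banach in finite dimension: a functional on [R^n] that attains the gauge [infF F] at the
    target [P] yields a combination [Xi] of the [xi j] of norm at most [1 / N]. Then
    [G Xi <= M / N < 1], so the gauge at [P] is below 1. *)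
Lemma goldstine (n : nat) (xi : 'I_n -> dual V) (e : R) : 0 < e ->
  exists2 v : V, rnorm v < N & forall j, `|rpart (xi j) v - G (xi j)| < e.
Proof.
move=> e0; have N0 : 0 < N by exact: le_lt_trans MN.
(* The inequality [F v P < 1] encodes both conclusions about [v], since each summand is
   nonnegative. *)
pose F (v : V) (c : 'rV[R]_n) : R :=
  rnorm v / N + \sum_(j < n) `|c ord0 j - rpart (xi j) v| / e.
have F_ge0 v c : 0 <= F v c.
  rewrite addr_ge0 ?divr_ge0 ?rnorm_ge0 ?(ltW N0)// sumr_ge0// => j _.
  by rewrite divr_ge0// ltW.
have FD c d x y : exists v, F v (x + y) <= F c x + F d y.
  exists (c + d); rewrite /F addrACA lerD//.
    by rewrite -mulrDl ler_pM2r ?invr_gt0// rnormD.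
  rewrite -big_split ler_sum//= => j _; rewrite -mulrDl ler_pM2r ?invr_gt0//.
  by rewrite mxE (rpart_linear _).1 opprD addrACA ler_normD.
pose rV : lmodType (scalar_field R RealScalars) :=
  'rV[scalar_field R RealScalars]_n.
have FZ c (r : R) (x : rV) : 0 < r ->
    exists v, F v (@sc_inj R RealScalars r *: x) <= r * F c x.
  move=> r0; exists (sc r *: c); rewrite /F rnormZ gtr0_norm// mulrDr mulrA.
  rewrite lerD// mulr_sumr ler_sum// => j _.
  rewrite mxE (rpart_linear _).2 /sc_inj -mulrBr normrM gtr0_norm//.
  by rewrite mulrA.
have pF v (c : rV) : @infF R RealScalars rV V F c <= F v c.
  exact: (@infF_le R RealScalars rV V (0 : V) F FD (fun v => F_ge0 v 0)).
have := @infF_sublinear R RealScalars rV V (0 : V) F FD FZ (fun v => F_ge0 v 0).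
pose P : 'rV[R]_n := \row_j G (xi j).
move=> /(@hahn_banach R RealScalars rV _ P) [u [ul uF uP]].
pose h j := u (delta_mx ord0 j).
have uE (c : 'rV[R]_n) : u c = \sum_j c ord0 j * h j.
  rewrite [X in u X = _](row_sum_delta c) (rlinear_sum _ _ _ ul).
  by apply: eq_bigr => j _; rewrite -ul.2.
pose Xi := \sum_j sc (h j) *: xi j.
have Xi_le : rnorm Xi <= N^-1.
  apply: rnorm_dual_le => [|v]; first by rewrite invr_ge0 ltW.
  rewrite /Xi (rlinear_sum _ _ _ (rpart_linearf v)).
  (* At the vector of exact values of [v] the error terms of [F v] vanish and only [rnorm v / N]
     remains. *)
  have -> : \sum_j rpart (sc (h j) *: xi j) v = u (\row_j rpart (xi j) v).
    by rewrite uE; apply: eq_bigr => j _; rewrite rpartZf mxE mulrC.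
  rewrite (le_trans (uF _))// (le_trans (pF v _))//.
  rewrite /F big1 ?addr0; first by rewrite mulrC.
  by move=> j _; rewrite mxE subrr normr0 mul0r.
have : @infF R RealScalars rV V F P < 1.
  rewrite -uP uE.
  have -> : \sum_j P ord0 j * h j = G Xi.
    rewrite (rlinear_sum _ _ _ Glin); apply: eq_bigr => j _.
    by rewrite Glin.2 mxE mulrC.
  rewrite (le_lt_trans (GM _))// (le_lt_trans (ler_wpM2l M0 Xi_le))//.
  by rewrite ltr_pdivrMr// mul1r.
move=> /(@infF_lt R RealScalars rV V (0 : V) F FD (fun v => F_ge0 v 0)) [v Fv].
exists v => [|j].
  rewrite -[ltRHS]mul1r -ltr_pdivrMr//; apply: le_lt_trans Fv.
  by rewrite /F lerDl sumr_ge0// => j _; rewrite divr_ge0// ltW.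
rewrite -[ltRHS]mul1r -ltr_pdivrMr//; apply: le_lt_trans Fv.
rewrite /F (bigD1 j)//= mxE distrC addrCA lerDl.
rewrite addr_ge0 ?divr_ge0 ?rnorm_ge0 ?(ltW N0)//.
by rewrite sumr_ge0// => i _; rewrite divr_ge0// ltW.
Qed.

(** The sets of [e]-approximants for finitely many functionals form a filter base; any ultrafilter
    refining it realizes [G] as a limit of evaluations. *)
Lemma goldstine_ultra : exists W : set_system V, [/\ UltraFilter W,
  (\forall v \near W, rnorm v < N) &
  forall f, rpart f v @[v --> W] --> G f].
Proof.
pose B (se : seq (dual V) * R) : set V := [set v | rnorm v < N /\
  forall f, f \in se.1 -> `|rpart f v - G f| < se.2].
pose D : set (seq (dual V) * R) := [set se | 0 < se.2].
have FB : ProperFilter (filter_from D B).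
  apply: filter_from_proper; last first.
    move=> [s e] /= e0.
    have [v vN vs] := goldstine (fun j : 'I_(size s) => nth 0 s j) e0.
    exists v; split => //= f /(nthP 0) [j js <-].
    exact: (vs (Ordinal js)).
  apply: filter_from_filter; first by exists ([::], 1) => /=; exact: ltr01.
  move=> [s e] [s' e'] /= e0 e0'; exists (s ++ s', Num.min e e') => /=.
    by rewrite /D /= lt_min; apply/andP.
  move=> v [vN vs] /=; split; split => // f fs.
    have /vs /= : f \in s ++ s' by rewrite mem_cat fs.
    by rewrite lt_min => /andP[].
  have /vs /= : f \in s ++ s' by rewrite mem_cat fs orbT.
  by rewrite lt_min => /andP[].
have [W [WU BW]] := ultraFilterLemma FB; exists W; split => //.
  by apply: BW; exists ([::], 1) => [|v []]//; exact: ltr01.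
move=> f; apply/cvgrPdist_lt => e e0; apply: BW.
exists ([:: f], e) => // v [_ /(_ f)] /=.
by rewrite mem_head distrC => /(_ isT).
Qed.

End Goldstine.

Section LimitFunctionals.
Variables (R : realType) (k : scalar_kind).
Local Notation K := (scalar_field R k).
Local Notation sc := (@sc_inj R k).
Variables (I : Type) (U : set_system I).
Context {UU : UltraFilter U}.

(** Banach-Alaoglu in ultrafilter form: the pointwise limits of the real parts are real-linear with
    the same bound. *)
Lemma dual_cvg (V : normedModType K) (f : I -> dual V) (M : R) :
  0 <= M -> (forall i, rnorm (f i) <= M) ->
  exists2 g : dual V, rnorm g <= M &
    forall x, rpart (f i) x @[i --> U] --> rpart g x.
Proof.
move=> M0 fM; have f_le i x : `|rpart (f i) x| <= M * rnorm x.
  by rewrite (le_trans (rpart_le _ _))// ler_wpM2r// rnorm_ge0.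
have /choice [l lP] : forall x, exists l : R, rpart (f i) x @[i --> U] --> l.
  by move=> x; apply: (@ultra_cvg _ _ _ _ _ (M * rnorm x)); exact: nearW.
have lE x (a : R) : rpart (f i) x @[i --> U] --> a -> l x = a.
  by move=> xa; exact: (cvg_unique (@norm_hausdorff _ R^o) (lP x) xa).
have llin : rlinear l.
  split=> [x y|r x]; apply: lE.
    apply: cvg_ext (cvgD (FF := _) (lP x) (lP y)) => i /=.
    by rewrite -(rpart_linear _).1.
  apply: cvg_ext (cvgM (FF := _) (cvg_cst (FF := _) r) (lP x)) => i /=.
  by rewrite -(rpart_linear _).2.
have [x|g gM gl] := dual_of_real M0 llin.
  apply: (cvgr_to_le (lP x)); apply: nearW => i.
  exact: le_trans (ler_norm _) (f_le i x).
by exists g => // x; rewrite gl.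
Qed.

End LimitFunctionals.

(** * Iterated ultrafilter quantifiers *)

Section IteratedUltrafilter.
Variables (T : eqType) (V : set_system T).
Context {UV : UltraFilter V}.
Implicit Types (P Q : seq T -> Prop) (l : seq T).

(* [P] holds for V-almost every [t_1], for V-almost every [t_2], ...; the order
   of the entries of the list is the order of the quantifiers. *)
Fixpoint iter_near (n : nat) P : Prop :=
  if n is n'.+1 then \forall t \near V, iter_near n' (fun l => P (t :: l))
  else P [::].

Lemma iter_nearS n P Q : (forall l, size l = n -> P l -> Q l) ->
  iter_near n P -> iter_near n Q.
Proof.
elim: n P Q => [|n IHn] P Q PQ /=; first exact: PQ.
by apply: filterS => t; apply: IHn => l ln; apply: PQ; rewrite /= ln.
Qed.

Lemma iter_nearW n P : (forall l, size l = n -> P l) -> iter_near n P.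
Proof.
elim: n P => [|n IHn] P PT /=; first exact: PT.
by apply: nearW => t; apply: IHn => l ln; apply: PT; rewrite /= ln.
Qed.

Lemma iter_nearI n P Q : iter_near n P -> iter_near n Q ->
  iter_near n (fun l => P l /\ Q l).
Proof.
elim: n P Q => [|n IHn] P Q /= Pn Qn; first by split.
by apply: filterS2 Pn Qn => t; exact: IHn.
Qed.

Lemma iter_near_forall n m (P : nat -> seq T -> Prop) :
  (forall i, (i < m)%N -> iter_near n (P i)) ->
  iter_near n (fun l => forall i, (i < m)%N -> P i l).
Proof.
elim: m => [|m IHm] Pm; first exact: iter_nearW.
have IHPm := IHm (fun i im => Pm i (ltnW im)).
apply: iter_nearS (iter_nearI IHPm (Pm m (ltnSn m))).
move=> l _ [Pl Pml] i; rewrite ltnS leq_eqVlt => /predU1P[->//|].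
exact: Pl.
Qed.

Lemma iter_near_ex n P : iter_near n P -> exists2 l, size l = n & P l.
Proof.
elim: n P => [|n IHn] P /=; first by exists [::].
by move=> /filter_ex [t /IHn [l ln Pl]]; exists (t :: l) => //=; rewrite ln.
Qed.

(** Iterated products of an ultrafilter are ultrafilters. The failure of a generic statement can
    thus be intersected with other generic statements. *)
Lemma iter_near_ultra n P : iter_near n P \/ iter_near n (fun l => ~ P l).
Proof.
elim: n P => [|n IHn] P /=; first by have [] := pselect (P [::]); [left|right].
have [|nP] := in_ultra_setVsetC [set t | iter_near n (fun l => P (t :: l))] UV.
  by left.
right; apply: filterS nP => t /= nPt.
by have [|//] := IHn (fun l => P (t :: l)).
Qed.

Lemma iter_near_all n (S : set T) :
  (\forall t \near V, S t) -> iter_near n (fun l => {in l, forall t, S t}).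
Proof.
move=> VS; elim: n => [|n IHn] //=; apply: filterS VS => t St.
apply: iter_nearS IHn => l _ Sl s; rewrite inE => /predU1P[->//|].
exact: Sl.
Qed.

Lemma iter_near_cat n m P :
  iter_near n (fun l => iter_near m (fun l' => P (l ++ l'))) ->
  iter_near (n + m) P.
Proof.
elim: n P => [|n IHn] P //=.
by apply: filterS => t; exact: IHn.
Qed.

(** Entries at increasing positions of a generic list form a generic list; this takes the place of
    extracting subsequences. In the induction, the head of the long list is either selected as [e 0]
    or skipped. *)
Lemma iter_near_embed (t0 : T) n n' (e : nat -> nat) P :
  (forall p, (p < n')%N -> (e p < n)%N) ->
  (forall p p', (p < p' < n')%N -> (e p < e p')%N) ->
  iter_near n' P ->
  iter_near n (fun l => P [seq nth t0 l (e p) | p <- iota 0 n']).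
Proof.
elim: n n' e P => [|n IHn] [|n'] e P en emono //=; first by have := en 0%N isT.
  by move=> P0; apply: nearW => t; apply: iter_nearW.
have [e0|e0] := posnP (e 0%N).
  have epos p : (p < n')%N -> (0 < e p.+1)%N.
    by move=> pn; rewrite -e0; apply: emono; rewrite /= ltnS.
  apply: filterS => t Pt; rewrite e0 /=.
  have := IHn n' (fun p => (e p.+1).-1) (fun l => P (t :: l)) _ _ Pt.
  have -> : iota 1 n' = map succn (iota 0 n').
    by rewrite -[1%N]/(1 + 0)%N iotaDl; apply: eq_map => p.
  move=> H; apply: iter_nearS (H _ _) => [l _|p pn|p p' pp'].
  - congr (P (_ :: _)); rewrite -map_comp; apply/eq_in_map => p.
    by rewrite mem_iota add0n /= => /epos; case: (e p.+1).
  - by have := en p.+1 pn; have := epos p pn; lia.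
  - have := emono p.+1 p'.+1 pp'; have := epos p; have := epos p'; lia.
move=> Pn; apply: nearW => t.
have epos p : (p < n'.+1)%N -> (0 < e p)%N.
  case: p => [//|p] pn; apply: (leq_trans e0); apply: ltnW.
  by apply: emono; rewrite /= pn.
have := IHn n'.+1 (fun p => (e p).-1) P _ _ Pn.
move=> H; apply: iter_nearS (H _ _) => [l _|p pn|p p' pp'].
- congr P; apply/eq_in_map => p.
  by rewrite mem_iota add0n /= => /epos; case: (e p).
- by have := en p pn; have := epos p pn; lia.
- have := emono p p' pp'; have := epos p; have := epos p'; lia.
Qed.

End IteratedUltrafilter.

(** Since [c <= b ^+ 3], and Bernoulli's inequality bounds [b ^+ n] by a multiple of [1 / (n + 1)],
    the product is of order [1 / (n + 1)]. *)
Lemma geometric_beats_square (R : realType) (c K eta : R) :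
  0 <= c < 1 -> 0 <= K -> 0 < eta ->
  exists n : nat, K * n.+1%:R ^+ 2 * c ^+ n < eta.
Proof.
move=> /andP[c0 c1] K0 eta0.
pose b := 1 - (1 - c) / 3; pose d := b^-1 - 1.
have b23 : 2 / 3 <= b by rewrite /b; lra.
have b1 : b < 1 by rewrite /b; lra.
have b0 : 0 < b by lra.
have cb : c <= b ^+ 3.
  have -> : c = 1 - 3 * (1 - b) by rewrite /b; field.
  have : 0 <= (b - 1) ^+ 2 * (b + 2) by rewrite mulr_ge0 ?sqr_ge0//; lra.
  have -> : (b - 1) ^+ 2 * (b + 2) = b ^+ 3 - 3 * b + 2 by ring.
  lra.
have bV : b^-1 = 1 + d by rewrite /d; lra.
have d0 : 0 < d by rewrite /d subr_gt0 invf_gt1.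
have d1 : d <= 1.
  have : b^-1 <= 2 by rewrite invf_ple ?posrE//; lra.
  by rewrite /d; lra.
have bern n : 1 + n%:R * d <= (1 + d) ^+ n.
  elim: n => [|n IHn]; first by rewrite mul0r addr0 expr0.
  rewrite exprS -natr1; have n0 : 0 <= n%:R :> R by [].
  nra.
have bn n : b ^+ n * (d * n.+1%:R) <= 1.
  have -> : b ^+ n = ((1 + d) ^+ n)^-1 by rewrite -bV exprVn invrK.
  rewrite ler_pdivrMl ?exprn_gt0//; last lra.
  rewrite mulr1; apply: le_trans (bern n).
  by rewrite -natr1; nra.
pose n := Num.truncn (K / (eta * d ^+ 3)); exists n.
have nK : K < eta * d ^+ 3 * n.+1%:R.
  rewrite mulrC -ltr_pdivrMr; first exact: truncnS_gt.
  by rewrite mulr_gt0// exprn_gt0.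
have cn : c ^+ n <= (b ^+ n) ^+ 3.
  by rewrite exprAC lerXn2r// ?nnegrE// exprn_ge0// ltW.
pose w : R := d * n.+1%:R.
have w0 : 0 < w by rewrite mulr_gt0.
have bw : b ^+ n <= w^-1 by rewrite -[leRHS]mul1r ler_pdivlMr.
have cw : c ^+ n <= w^-1 ^+ 3.
  by apply: (le_trans cn); rewrite lerXn2r// ?nnegrE ?invr_ge0 ?exprn_ge0 ?ltW.
apply: (@le_lt_trans _ _ (K * n.+1%:R ^+ 2 * w^-1 ^+ 3)).
  by rewrite ler_wpM2l// mulr_ge0// exprn_ge0.
rewrite exprVn ltr_pdivrMr ?exprn_gt0//.
have -> : eta * w ^+ 3 = (eta * d ^+ 3 * n.+1%:R) * n.+1%:R ^+ 2.
  by rewrite /w; ring.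
by rewrite ltr_pM2r// exprn_gt0.
Qed.

(** * James' theorem *)

Section James.
Variables (R : realType) (k : scalar_kind).
Local Notation K := (scalar_field R k).
Local Notation sc := (@sc_inj R k).

(** The opposite of the signed sum of J-convexity, with the same norm. A minus sign on the first
    terms will match the sign change of a pattern shifted past a block boundary. *)
Definition jsum (X : zmodType) (m : nat) (x : 'I_m -> X) (j : nat) : X :=
  \sum_(i < m) (if (i <= j)%N then - x i else x i).

(* [psi] and [om] are the inner limits of [phi t x] in [x] and in [t]; [al] and
   [be] are the two iterated limits.  The limit in [x] is only available through
   [near_b], which approximates finitely many functionals at a time. *)
Variables (X : lmodType K) (T : eqType) (V : set_system T).
Context {UV : UltraFilter V}.
Variables (t0 : T) (phi : T -> X -> R) (psi : T -> R) (om : X -> R) (al be : R).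
Variables (q nx : X -> R) (m : nat) (c C D eta : R).

Hypothesis phi_lin : forall t, rlinear (phi t).
Hypothesis psi_lim : psi t @[t --> V] --> al.
Hypothesis om_lim : forall x, phi t x @[t --> V] --> om x.
Hypothesis be_al : be < al.
Hypothesis near_b : forall (F : seq T) (e : R), 0 < e -> exists b,
  [/\ nx b <= C, {in F, forall t, `|phi t b - psi t| <= e} & `|om b - be| <= e].

Hypothesis nxD : forall x y, nx (x + y) <= nx x + nx y.
Hypothesis nxN : forall x, nx (- x) = nx x.
Hypothesis nxZ : forall (r : R) x, 0 <= r -> nx (sc r *: x) = r * nx x.
Hypothesis nx_ge0 : forall x, 0 <= nx x.

(** The norm [nx] bounds the approximating points, whereas the contraction runs on [q]; [q_nx]
    passes from one to the other, and [q_eta] keeps [q] away from 0 at the end. *)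
Hypothesis q_nx : forall x, q x <= D * nx x ^+ 2.
Hypothesis D0 : 0 <= D.
Hypothesis m0 : (0 < m)%N.
Hypothesis c01 : 0 <= c < 1.
Hypothesis q_jsum : forall (x : 'I_m -> X) (t : R), (forall i, q (x i) <= t) ->
  exists2 j, (j < m)%N & q (sc m%:R^-1 *: jsum x j) <= c * t.
Hypothesis eta0 : 0 < eta.
Hypothesis q_eta : \forall t \near V, forall x, 1 <= phi t x -> eta <= q x.

Definition signed_pattern (n : nat) (sg : nat -> R) (l : seq T) (x : X) :=
  forall p, (p < n)%N -> 1 <= sg p * phi (nth t0 l p) x.

Definition attainable (n : nat) (sg : nat -> R) (s : R) : Prop :=
  iter_near V n (fun l => exists2 x, q x <= s & signed_pattern n sg l x).

Definition block_sign (r p : nat) : R := (-1) ^+ (p %/ r).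

(** All block lengths are required at once because a contraction trades blocks of length [m * r] for
    blocks of length [r]. *)
Definition blocks_attainable (n : nat) (s : R) : Prop :=
  forall r, (0 < r)%N -> attainable (n * r) (block_sign r) s.

Let nth_embed (l : seq T) (e : nat -> nat) n p : (p < n)%N ->
  nth t0 [seq nth t0 l (e i) | i <- iota 0 n] p = nth t0 l (e p).
Proof. by move=> pn; rewrite (nth_map 0%N) ?size_iota// nth_iota. Qed.

(* If [x_i] alternates on blocks of length [m * r] shifted by [(m - i) * r],
   then [jsum x j / m] alternates on the blocks of length [r] found at positions
   [(l * m + j) * r + t], [t < r]. *)
Lemma blocks_attainable_contract n s :
  blocks_attainable n.+1 s -> blocks_attainable n (c * s).
Proof.
move=> bs r r0.
pose good l := exists2 x, q x <= c * s &
  signed_pattern (n * r) (block_sign r) l x.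
have [//|bad] := iter_near_ultra (UV := UV) (n * r) good.
exfalso; pose N := (n * (m * r))%N.
pose A i l := exists2 x, q x <= s &
  forall p, (p < N)%N ->
    1 <= block_sign (m * r) (p + (m - i) * r) * phi (nth t0 l p) x.
(* The additional block in the hypothesis leaves room for a shift by at most [m * r]. *)
have A_near i : (i < m)%N -> iter_near V N (A i).
  move=> im; have [//|nA] := iter_near_ultra (UV := UV) N (A i); exfalso.
  have mr0 : (0 < m * r)%N by rewrite muln_gt0 m0.
  pose e p := (p + (m - i) * r)%N.
  have eN p : (p < N)%N -> (e p < n.+1 * (m * r))%N.
    have : ((m - i) * r <= m * r)%N by rewrite leq_mul2r leq_subr orbT.
    by rewrite /e /N mulSn; lia.
  have emono p p' : (p < p' < N)%N -> (e p < e p')%N.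
    by move=> /andP[pp' _]; rewrite /e ltn_add2r.
  have nA' := iter_near_embed (UV := UV) t0 eN emono nA.
  have [l _ [[x xs xl]]] :=
    iter_near_ex (UV := UV) (iter_nearI (UV := UV) (bs _ mr0) nA').
  apply; exists x => // p pN; rewrite nth_embed//.
  by have := xl (e p) (eN p pN).
pose e j p := (((p %/ r) * m + j) * r + p %% r)%N.
have bad_near j : (j < m)%N -> iter_near V N
    (fun l => ~ good [seq nth t0 l (e j p) | p <- iota 0 (n * r)]).
  move=> jm; apply: iter_near_embed bad => [p pn|p p' /andP[pp' _]]; rewrite /e.
    have := ltn_pmod p r0; have : (p %/ r < n)%N by rewrite ltn_divLR.
    by rewrite /N; nia.
  have := ltn_pmod p r0; have := ltn_pmod p' r0.
  have := divn_eq p r; have := divn_eq p' r.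
  set a := (p %/ r)%N; set a' := (p' %/ r)%N.
  set b := (p %% r)%N; set b' := (p' %% r)%N.
  move=> pE p'E b'r br; have [aa'|a'a|aa'] := ltngtP a a'; last 1 first.
  - by rewrite aa' ltn_add2l; move: pp'; rewrite pE p'E aa' ltn_add2l.
  - have : (a.+1 * r <= a' * r)%N by rewrite leq_mul2r aa' orbT.
    have : (a.+1 * m + j <= a' * m + j)%N.
      by rewrite leq_add2r leq_mul2r aa' orbT.
    nia.
  - by exfalso; nia.
(* A single list has to serve all [i] and all [j], because the [j] given by [q_jsum] depends on the
   vectors found for that list. *)
have A_all := iter_near_forall (UV := UV) A_near.
have bad_all := iter_near_forall (UV := UV) bad_near.
have [l _ [lA lbad]] :=
  iter_near_ex (UV := UV) (iter_nearI (UV := UV) A_all bad_all).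
have /choice [x xA] : forall i : 'I_m, exists x, q x <= s /\
    forall p, (p < N)%N ->
      1 <= block_sign (m * r) (p + (m - i) * r) * phi (nth t0 l p) x.
  by move=> i; have [x xs xl] := lA i (ltn_ord i); exists x.
have [j jm qj] := q_jsum (fun i => (xA i).1).
apply: (lbad j jm); exists (sc m%:R^-1 *: jsum x j) => // p pn.
rewrite nth_embed// (phi_lin _).2 /jsum (rlinear_sum _ _ _ (phi_lin _)).
have ejN : (e j p < N)%N.
  rewrite /e; have := ltn_pmod p r0; have : (p %/ r < n)%N by rewrite ltn_divLR.
  by rewrite /N; nia.
rewrite mulrCA mulrC ler_pdivlMr ?ltr0n// mul1r mulr_sumr.
have -> : m%:R = \sum_(i < m) 1 :> R by rewrite sumr_const card_ord.
apply: ler_sum => i _; have := (xA i).2 _ ejN.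
(* The shift by [(m - i) * r] crosses a boundary of the long blocks exactly when [i <= j]; the minus
   sign in [jsum] cancels the resulting sign change. *)
suff -> : block_sign (m * r) (e j p + (m - i) * r) =
    if (i <= j)%N then - block_sign r p else block_sign r p.
  case: leqP => _ //; rewrite (rlinearN _ (phi_lin _)); lra.
rewrite /block_sign /e.
have -> : (((p %/ r * m + j) * r + p %% r + (m - i) * r) %/ (m * r) =
    p %/ r + (i <= j))%N.
  have im := ltn_ord i.
  have -> : ((p %/ r * m + j) * r + p %% r + (m - i) * r =
    (p %/ r * m + (j + (m - i))) * r + p %% r)%N by nia.
  rewrite (mulnC m r) divnMA divnMDl//.
  rewrite [(p %% r %/ r)%N]divn_small ?ltn_pmod// addn0.
  rewrite divnMDl//; congr addn; case: leqP => ij.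
    have -> : (j + (m - i) = 1 * m + (j - i))%N by lia.
    by rewrite divnMDl// divn_small//; lia.
  by rewrite divn_small//; lia.
by rewrite exprD; case: leqP => _; rewrite ?expr1 ?expr0 ?mulr1 ?mulrN1.
Qed.

Let C0 : 0 <= C.
Proof.
by have [b [bC _ _]] := near_b [::] ltr01; exact: le_trans (nx_ge0 b) bC.
Qed.

(* [b' - b] with [b] chosen before and [b'] after the first block is nearly
   [al - be] on that block and nearly [0] on everything else. *)
Lemma bumps (n r : nat) (e sg : R) (F : seq T) : 0 < e -> sg ^+ 2 = 1 ->
  {in F, forall t, `|psi t - al| <= e} ->
  iter_near V (n * r) (fun l => exists x, [/\ nx x <= 2 * C * n%:R,
    {in F, forall t, `|phi t x| <= 4 * e * n%:R} &
    forall p, (p < n * r)%N ->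
      al - be - 4 * e * n%:R <= sg * block_sign r p * phi (nth t0 l p) x]).
Proof.
move=> e0; elim: n sg F => [|n IHn] sg F sg1 Fal.
  apply: iter_nearW => l _; exists 0; split => //.
  - by rewrite mulr0 -(scale0r 0) -(sc_inj0 R k) nxZ// mul0r.
  - by move=> t _; rewrite rlinear0// normr0 mulr0.
have sgE : sg = 1 \/ sg = -1.
  by apply/pred2P; rewrite -eqf_sqr expr1n sg1.
have [b [bC bF bbe]] := near_b F e0.
have om_near x : \forall t \near V, `|phi t x - om x| <= e.
  by apply: cvg_near_le => //; exact: om_lim.
have psi_near : \forall t \near V, `|psi t - al| <= e.
  by apply: cvg_near_le.
rewrite mulSn; apply: iter_near_cat.
have block_near : \forall t \near V,
    `|phi t b - om b| <= e /\ `|psi t - al| <= e.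
  by apply: filterI; [exact: om_near|exact: psi_near].
apply: iter_nearS (iter_near_all r block_near) => l lr lb.
have [b' [b'C b'F b'be]] := near_b (F ++ l) e0.
have lal : {in F ++ l, forall t, `|psi t - al| <= e}.
  by move=> t; rewrite mem_cat => /orP[/Fal//|/lb[]].
have sgN : (- sg) ^+ 2 = 1 by rewrite sqrrN.
have rest_near : \forall t \near V,
    `|phi t b - om b| <= e /\ `|phi t b' - om b'| <= e.
  by apply: filterI; exact: om_near.
have l'_near := iter_near_all (UV := UV) (n * r) rest_near.
(* The first block [l] joins the list of protected functionals, so that the later bumps stay small
   on it. *)
apply: iter_nearS (iter_nearI (IHn _ _ sgN lal) l'_near).
move=> l' l'n [[x [xC xF xl]] l'b].
(* On each of the three ranges of [t], at most four approximations of size [e] enter, whence the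
   constant 4. *)
pose u := b' - b; have uE t : phi t u = phi t b' - phi t b by exact: rlinearB.
have uF t : t \in F -> `|phi t u| <= 4 * e.
  move=> tF; have := bF t tF; have := b'F t; rewrite mem_cat tF => /(_ isT).
  rewrite uE !ler_norml; lra.
have ul t : t \in l -> al - be - 4 * e <= phi t u.
  move=> tl; have [/= + +] := lb t tl; have := b'F t.
  rewrite mem_cat tl orbT => /(_ isT); move: bbe; rewrite uE !ler_norml; lra.
have ul' t : t \in l' -> `|phi t u| <= 4 * e.
  move=> tl; have [/= + +] := l'b t tl.
  by move: bbe b'be; rewrite uE !ler_norml; lra.
have phisg t : phi t (sc sg *: u + x) = sg * phi t u + phi t x.
  by rewrite (phi_lin _).1 (phi_lin _).2.
exists (sc sg *: u + x); split.
- rewrite (le_trans (nxD _ _))// -(natr1 n) mulrDr mulr1 addrC lerD//.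
  have -> : nx (sc sg *: u) = nx u.
    by case: sgE => ->; rewrite ?sc_injN ?scaleNr ?nxN sc_inj1 scale1r.
  by rewrite (le_trans (nxD _ _))// nxN; lra.
- move=> t tF; have := xF t; rewrite mem_cat tF => /(_ isT).
  have := uF t tF; rewrite phisg -(natr1 n) !ler_norml.
  by case: sgE => ->; rewrite ?mul1r ?mulN1r; lra.
- move=> p pn; rewrite nth_cat lr phisg -(natr1 n); case: ltnP => pr.
    have tl : nth t0 l p \in l by rewrite mem_nth ?lr.
    rewrite /block_sign divn_small// expr0 mulr1.
    have := xF (nth t0 l p); rewrite mem_cat tl orbT => /(_ isT).
    have := ul _ tl; rewrite !ler_norml.
    by case: sgE => ->; rewrite ?mul1r ?mulN1r; lra.
  have pn' : (p - r < n * r)%N by rewrite ltn_subLR// -mulSn.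
  have tl : nth t0 l' (p - r) \in l' by rewrite mem_nth ?l'n.
  have := xl _ pn'; have := ul' _ tl.
  have -> : sg * block_sign r p = - sg * block_sign r (p - r).
    rewrite /block_sign -[in LHS](subnK pr) -[X in (_ + X)%N]mul1n.
    have r0 : (0 < r)%N by case: (r) pn' => [|//]; rewrite muln0.
    by rewrite addnC divnMDl// exprS mulrA mulrN1.
  have : `|- sg * block_sign r (p - r)| = 1.
    rewrite /block_sign normrM normrN normrX normrN1 expr1n mulr1.
    by case: sgE => ->; rewrite ?normrN normr1.
  move: (- sg * _) => w w1 uw xw.
  have := sgE; have : `|w * (sg * phi (nth t0 l' (p - r)) u)| <= 4 * e.
    by rewrite !normrM w1 mul1r; case: sgE => ->; rewrite ?normrN normr1 mul1r.
  rewrite mulrDr ler_norml; lra.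
Qed.

(** The choice of [e] makes the accumulated error [4 e n] half of the gap [al - be]. Rescaling by
    [2 / (al - be)] then lifts the values to at least 1, at a cost quadratic in [n]. *)
Lemma blocks_attainable_bound n :
  blocks_attainable n (D * (4 * C / (al - be)) ^+ 2 * n%:R ^+ 2).
Proof.
move=> r r0; have ab : 0 < al - be by rewrite subr_gt0.
have [->|n0] := posnP n.
  apply: iter_nearW => l _; exists 0 => [|p].
    rewrite (le_trans (q_nx _))// -(scale0r 0) -(sc_inj0 R k) nxZ//.
    by rewrite mul0r expr0n !mulr0.
  by rewrite mul0n.
pose e := (al - be) / (8 * n%:R); have n0' : 0 < n%:R :> R by rewrite ltr0n.
have e0 : 0 < e by rewrite divr_gt0// mulr_gt0.
have := @bumps n r e 1 [::] e0 (expr1n _ _) (fun _ => ltac:(by [])).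
apply: iter_nearS => l _ [x [xC _ xl]].
have g0 : 0 <= 2 / (al - be) by rewrite divr_ge0// ltW.
exists (sc (2 / (al - be)) *: x).
  rewrite (le_trans (q_nx _))// -mulrA ler_wpM2l// nxZ// -exprMn.
  rewrite lerXn2r ?nnegrE ?mulr_ge0 ?invr_ge0 ?(ltW ab)//.
  have -> : 4 * C / (al - be) * n%:R = 2 / (al - be) * (2 * C * n%:R) by ring.
  by rewrite ler_wpM2l.
move=> p /xl; rewrite (phi_lin _).2 mul1r.
have -> : 4 * e * n%:R = (al - be) / 2.
  by rewrite /e; field; rewrite gt_eqF.
move=> H; rewrite mulrCA -ler_pdivrMl ?divr_gt0// mulr1 invf_div.
lra.
Qed.

(** Contracting [n] times from [n + 1] blocks leaves one block, attained with [q] of order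
    [(n + 1) ^ 2 c ^ n]. For a suitable [n] this lies below [eta]. *)
Theorem james_contradiction : False.
Proof.
pose B := D * (4 * C / (al - be)) ^+ 2.
have B0 : 0 <= B by rewrite mulr_ge0// sqr_ge0.
have contract i n s :
    blocks_attainable (n + i) s -> blocks_attainable n (c ^+ i * s).
  elim: i s => [|i IHi] s; first by rewrite addn0 expr0 mul1r.
  rewrite addnS => /blocks_attainable_contract /IHi.
  by rewrite exprSr mulrA.
have [n nB] := geometric_beats_square c01 B0 eta0.
have /contract /(_ 1%N isT) near1 := @blocks_attainable_bound (1 + n)%N.
have near_eta := iter_near_all (UV := UV) (1 * 1) q_eta.
have [[|t [|? ?]] //= _ [[x xs xt] tq]] :=
  iter_near_ex (UV := UV) (iter_nearI (UV := UV) near1 near_eta).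
have := xt 0%N isT; rewrite /block_sign div0n expr0 mul1r /= => xt1.
have := le_trans (tq t (mem_head _ _) x xt1) xs.
by rewrite leNgt -/B add1n mulrC nB.
Qed.

End James.

(** * J-convexity *)

Section JConvexity.
Variables (R : realType) (k : scalar_kind).
Local Notation K := (scalar_field R k).
Local Notation sc := (@sc_inj R k).

Definition J_convex (E : normedModType K) : Prop :=
  exists (m : nat) (e : R), [/\ (0 < m)%N, 0 < e & forall z : 'I_m -> E,
    (forall i, rnorm (z i) <= 1) ->
    exists2 j, (j < m)%N & rnorm (jsum z j) <= m%:R - e].

Let sum_const_neq (n : nat) (i0 : 'I_n) (a : R) :
  \sum_(i < n | i != i0) a = (n%:R - 1) * a.
Proof.
have : \sum_(i < n) a = n%:R * a by rewrite sumr_const card_ord mulr_natl.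
by rewrite (bigD1 i0)//=; lra.
Qed.

(** Let [f j] norm [jsum z j], whose norm exceeds [m - 1/2]. Its [m] terms are at most 1 under
    [f j], so each of them is at least 1/2. *)
Lemma not_J_convex (E : normedModType K) : ~ J_convex E -> forall m : nat,
  exists (z : nat -> E) (f : nat -> dual E),
    [/\ forall i, rnorm (z i) <= 1, forall j, rnorm (f j) <= 1,
      forall i j, (i <= j < m)%N -> rpart (f j) (z i) <= - 2^-1 &
      forall i j, (j < i < m)%N -> 2^-1 <= rpart (f j) (z i)].
Proof.
move=> nJ [|m].
  exists (fun=> 0), (fun=> 0); split => [i|j|i j|i j]; rewrite ?rnorm0//.
    by rewrite ltn0 andbF.
  by rewrite ltn0 andbF.
have [z [z1 zJ]] : exists z : 'I_m.+1 -> E, (forall i, rnorm (z i) <= 1) /\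
    forall j, (j < m.+1)%N -> m.+1%:R - 2^-1 < rnorm (jsum z j).
  apply: contrapT => nz; apply: nJ; exists m.+1, 2^-1; split => // z z1.
  apply: contrapT => nj; apply: nz; exists z; split => // j jm.
  by rewrite ltNge; apply/negP => jz; apply: nj; exists j.
have /choice [f fP] : forall j, exists f : dual E, rnorm f <= 1 /\
    rpart f (jsum z j) = rnorm (jsum z j).
  by move=> j; have [f f1 fz] := norming_functional (jsum z j); exists f.
pose s i j : R := if (i <= j)%N then -1 else 1.
have fz i j : `|rpart (f j) (z i)| <= 1.
  rewrite (le_trans (rpart_le _ _))// mulr_ile1 ?rnorm_ge0//.
  exact: (fP j).1.
have fs (i : 'I_m.+1) j : (j < m.+1)%N -> 2^-1 <= s i j * rpart (f j) (z i).
  move=> jm; have := zJ j jm; rewrite -(fP j).2 /jsum.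
  rewrite (rlinear_sum _ _ _ (rpart_linear _)).
  rewrite (bigD1 i)//= => zi.
  have : \sum_(l < m.+1 | l != i)
      rpart (f j) (if (l <= j)%N then - z l else z l) <= m%:R.
    have -> : m%:R = \sum_(l < m.+1 | l != i) 1 :> R.
      by rewrite sum_const_neq -natr1; lra.
    apply: ler_sum => l _; have := fz l j; rewrite ler_norml => /andP[l1 l2].
    by case: ifP => _ //; rewrite (rlinearN _ (rpart_linear _)); lra.
  move: zi; rewrite /s -natr1; case: ifP => _;
    rewrite ?(rlinearN _ (rpart_linear _)); lra.
exists (fun i => z (inord i)), f.
split => [//|j|i j|i j]; first exact: (fP j).1.
  move=> /andP[ij jm]; have := fs (inord i) j jm.
  by rewrite /s inordK ?ij ?(leq_ltn_trans ij)//; lra.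
move=> /andP[ij jm]; have := fs (inord i) j (ltn_trans ij jm).
by rewrite /s inordK// leqNgt ij /= mul1r.
Qed.

Section Jsum.
Variables (X : lmodType K) (m : nat).
Implicit Types x y : 'I_m -> X.

Lemma jsumD x y j : jsum (fun i => x i + y i) j = jsum x j + jsum y j.
Proof.
rewrite /jsum -big_split; apply: eq_bigr => i _.
by case: ifP => //; rewrite opprD.
Qed.

Lemma jsumZ a x j : jsum (fun i => a *: x i) j = a *: jsum x j.
Proof.
rewrite /jsum scaler_sumr; apply: eq_bigr => i _.
by case: ifP => //; rewrite scalerN.
Qed.

End Jsum.

Lemma rnorm_jsum (E : normedModType K) m (z : 'I_m -> E) j :
  rnorm (jsum z j) <= \sum_(i < m) rnorm (z i).
Proof.
rewrite (le_trans (rnorm_sum _ _ _))// ler_sum// => i _.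
by case: ifP => //; rewrite rnormN.
Qed.

(** The Cauchy-Schwarz defect is the sum of all [(m t_i - S) ^ 2 / m]; only the term of [i0] is
    kept. *)
Lemma sum_sqr_ge (m : nat) (t : 'I_m -> R) i0 :
  (\sum_i t i) ^+ 2 + (m%:R * t i0 - \sum_i t i) ^+ 2 / m%:R <=
  m%:R * \sum_i t i ^+ 2.
Proof.
have m0 : 0 < m%:R :> R by rewrite ltr0n; case: m i0 {t} => [[]|].
set S := \sum_i t i; set Q := \sum_i t i ^+ 2.
have -> : m%:R * Q = S ^+ 2 + (\sum_i (m%:R * t i - S) ^+ 2) / m%:R.
  have -> : \sum_i (m%:R * t i - S) ^+ 2 =
      m%:R ^+ 2 * Q - 2 * m%:R * S * S + m%:R * S ^+ 2.
    rewrite (eq_bigr (fun i => m%:R ^+ 2 * t i ^+ 2 +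
      (- (2 * m%:R * S)) * t i + S ^+ 2)).
      rewrite !big_split /= -!mulr_sumr sumr_const card_ord -/S -/Q -mulr_natl.
      ring.
    by move=> i _; ring.
  by field; rewrite gt_eqF.
rewrite lerD2l ler_pM2r ?invr_gt0// (bigD1 i0)//= lerDl.
by apply: sumr_ge0 => i _; exact: sqr_ge0.
Qed.

(* Being quadratic, this form of J-convexity survives averaging. *)
Lemma J_convex_quadratic (E : normedModType K) : J_convex E ->
  exists (m : nat) (c : R), [/\ (0 < m)%N, 0 <= c < 1 & forall z : 'I_m -> E,
    \sum_(j < m) rnorm (jsum z j) ^+ 2 <=
    c * m%:R ^+ 2 * \sum_(i < m) rnorm (z i) ^+ 2].
Proof.
move=> [m [e [m0 e0 J]]].
have M0 : 0 < m%:R :> R by rewrite ltr0n.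
set M : R := m%:R in M0 *.
(* If the smallest norm is at least half the mean, J-convexity yields the factor [c1]; otherwise the
   norms are spread out and the Cauchy-Schwarz defect yields [c2]. *)
pose c1 := 1 - e / (2 * M ^+ 2); pose c2 := 4 * M / (4 * M + 1).
have c2_ge0 : 0 <= c2 by rewrite divr_ge0 ?addr_ge0 ?mulr_ge0 ?ltW.
exists m, (Num.max c1 c2); split => //.
  rewrite le_max c2_ge0 orbT /= gt_max /c1 /c2; apply/andP; split.
    by rewrite ltrBlDr ltrDl divr_gt0// mulr_gt0// exprn_gt0.
  by rewrite ltr_pdivrMr; lra.
move=> z; pose t i := rnorm (z i); set S := \sum_i t i.
have t0 i : 0 <= t i by exact: rnorm_ge0.
have S0 : 0 <= S by exact: sumr_ge0.
have [i0 _ tmin] := @arg_minP _ _ _ (Ordinal m0) xpredT t isT.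
have [j0 j0m zj0] : exists2 j, (j < m)%N & rnorm (jsum z j) <= S - e * t i0.
  have [ti0|ti0] := eqVneq (t i0) 0.
    by exists 0%N => //; rewrite ti0 mulr0 subr0; exact: rnorm_jsum.
  have tpos i : 0 < t i.
    by apply: lt_le_trans (tmin i isT); rewrite lt_neqAle eq_sym ti0 t0.
  have [i|j jm jJ] := J (fun i => sc (t i)^-1 *: z i).
    by rewrite rnormZ gtr0_norm ?invr_gt0// mulVf ?gt_eqF.
  exists j => //.
  (* Each [z i] splits into a vector of the smallest norm [t i0], to which J-convexity applies, and
     a remainder of norm [t i - t i0]. *)
  have -> : z = fun i =>
      sc (t i0) *: (sc (t i)^-1 *: z i) + sc (1 - t i0 / t i) *: z i.
    apply/funext => i; rewrite scalerA -sc_injM -scalerDl -sc_injD.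
    by rewrite subrKC sc_inj1 scale1r.
  rewrite jsumD jsumZ (le_trans (rnormD _ _))// rnormZ gtr0_norm//.
  have -> : S - e * t i0 = t i0 * (M - e) + \sum_i (t i - t i0).
    rewrite sumrB sumr_const card_ord -mulr_natl -/S -/M; ring.
  rewrite lerD ?ler_pM2l// (le_trans (rnorm_jsum _ _))// ler_sum// => i _.
  have ti : t i0 / t i <= 1 by rewrite ler_pdivrMr// mul1r tmin.
  rewrite rnormZ ger0_norm ?subr_ge0// mulrBl mul1r mulfVK ?gt_eqF//.
have a0 : 0 <= S - e * t i0 by exact: le_trans (rnorm_ge0 _) zj0.
have sumM : \sum_(j < m) rnorm (jsum z j) ^+ 2 <= M * S ^+ 2 - e * t i0 * S.
  rewrite (bigD1 (Ordinal j0m))//=.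
  have H1 : rnorm (jsum z j0) ^+ 2 <= S ^+ 2 - e * t i0 * S.
    apply: (@le_trans _ _ ((S - e * t i0) ^+ 2)).
      by rewrite lerXn2r ?nnegrE ?rnorm_ge0.
    have : 0 <= e * t i0 * (S - e * t i0) by rewrite !mulr_ge0// ltW.
    suff -> : S ^+ 2 - e * t i0 * S =
        (S - e * t i0) ^+ 2 + e * t i0 * (S - e * t i0) by rewrite lerDl.
    ring.
  have H2 : \sum_(j < m | j != Ordinal j0m) rnorm (jsum z j) ^+ 2 <=
      (M - 1) * S ^+ 2.
    have -> : (M - 1) * S ^+ 2 = \sum_(j < m | j != Ordinal j0m) S ^+ 2.
      by rewrite sum_const_neq.
    apply: ler_sum => j _; rewrite lerXn2r ?nnegrE ?rnorm_ge0//.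
    exact: rnorm_jsum.
  by move: H1 H2; lra.
have CS := sum_sqr_ge t i0; rewrite -/S -/M in CS.
set Q := \sum_i t i ^+ 2 in CS.
have Q0 : 0 <= Q by apply: sumr_ge0 => i _; exact: sqr_ge0.
apply: (le_trans sumM); rewrite -(mulrA (Num.max c1 c2)).
have MQ : S ^+ 2 <= M * Q.
  by apply: le_trans CS; rewrite lerDl divr_ge0 ?sqr_ge0// ltW.
have [ts|ts] := leP (S / (2 * M)) (t i0).
  apply: (@le_trans _ _ (c1 * (M * S ^+ 2))).
    have -> : c1 * (M * S ^+ 2) = M * S ^+ 2 - e * (S / (2 * M)) * S.
      by rewrite /c1; field; rewrite gt_eqF.
    by rewrite lerD2l lerN2 ler_wpM2r// ler_pM2l//.
  apply: (@le_trans _ _ (Num.max c1 c2 * (M * S ^+ 2))).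
    by rewrite ler_wpM2r ?le_max ?lexx// mulr_ge0 ?sqr_ge0 ?ltW.
  rewrite ler_wpM2l ?le_max ?c2_ge0 ?orbT// expr2 -mulrA ler_pM2l//.
apply: (@le_trans _ _ (c2 * (M ^+ 2 * Q))); last first.
  by rewrite ler_wpM2r ?le_max ?lexx ?orbT// mulr_ge0 ?sqr_ge0.
have H1 : S ^+ 2 / (4 * M) <= (M * t i0 - S) ^+ 2 / M.
  rewrite ler_pdivrMr ?mulr_gt0//.
  have -> : (M * t i0 - S) ^+ 2 / M * (4 * M) = (2 * (S - M * t i0)) ^+ 2.
    by field; rewrite gt_eqF.
  rewrite lerXn2r ?nnegrE//; move: ts; rewrite ltr_pdivlMr ?mulr_gt0//; nra.
have H2 : S ^+ 2 * (4 * M + 1) <= 4 * M * (M * Q).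
  have H3 : S ^+ 2 + S ^+ 2 / (4 * M) <= M * Q by lra.
  have -> : S ^+ 2 * (4 * M + 1) = 4 * M * (S ^+ 2 + S ^+ 2 / (4 * M)).
    by field; rewrite gt_eqF.
  by rewrite ler_pM2l// mulr_gt0.
apply: (@le_trans _ _ (M * S ^+ 2)).
  by rewrite gerBl !mulr_ge0// ltW.
have -> : c2 * (M ^+ 2 * Q) = M * (4 * M * (M * Q) / (4 * M + 1)).
  by rewrite /c2; field; rewrite gt_eqF; lra.
by rewrite ler_pM2l// ler_pdivlMr//; lra.
Qed.

(** The best [j] does at least as well as the average; this supplies the hypothesis [q_jsum] of
    James' argument. *)
Lemma quadratic_jsum (X : lmodType K) (q : X -> R) (m : nat) (c : R) :
  (0 < m)%N -> 0 <= c -> (forall (r : R) x, q (sc r *: x) = r ^+ 2 * q x) ->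
  (forall x : 'I_m -> X,
    \sum_(j < m) q (jsum x j) <= c * m%:R ^+ 2 * \sum_(i < m) q (x i)) ->
  forall (x : 'I_m -> X) (t : R), (forall i, q (x i) <= t) ->
  exists2 j, (j < m)%N & q (sc m%:R^-1 *: jsum x j) <= c * t.
Proof.
move=> m0 c0 qZ qJ x t xt; apply: contrapT => nj.
have M0 : 0 < m%:R :> R by rewrite ltr0n.
have qj (j : 'I_m) : m%:R ^+ 2 * (c * t) < q (jsum x j).
  rewrite -ltr_pdivlMl ?exprn_gt0// -exprVn -qZ ltNge.
  by apply/negP => H; apply: nj; exists j.
have : \sum_(j < m) (m%:R ^+ 2 * (c * t)) < \sum_(j < m) q (jsum x j).
  apply: ltr_sum => //; apply/hasP.
  by exists (Ordinal m0); rewrite ?mem_index_enum.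
rewrite ltNge => /negP; apply; apply: (le_trans (qJ x)).
rewrite [leRHS](_ : _ = c * m%:R ^+ 2 * \sum_(i < m) t).
  by rewrite ler_wpM2l ?ler_sum// mulr_ge0// exprn_ge0// ltW.
by rewrite -!mulr_sumr; ring.
Qed.

End JConvexity.

(** * Spaces that are not J-convex *)

Section UltrapowerNorm.
Variables (R : realType) (k : scalar_kind).
Local Notation K := (scalar_field R k).
Local Notation sc := (@sc_inj R k).
Variables (E : normedModType K) (I : Type) (U : set_system I).
Variable UU : UltraFilter U.
Local Notation EU := (@ultrapower R k E I U UU).
Local Notation cls := (@ucls R k E I U UU).

Definition linf_of (x : I -> E) (M : R) (xM : forall i, rnorm (x i) <= M) :
  linf E I :=
  @mk_linf _ E I x (sc M) (fun i => etrans (esym (rnorm_le _ _)) (xM i)).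

Lemma linf_rbounded (x : linf E I) : exists M : R, forall i, rnorm (x i) <= M.
Proof.
have [M xM] := linfP x; exists (sc_re M) => i; rewrite rnorm_le sc_reK//.
exact: le_trans (xM i).
Qed.

Lemma rnorm_ucls (x : linf E I) : rnorm (x i) @[i --> U] --> rnorm (cls x).
Proof.
suff -> : rnorm (cls x) = ulimr U x by exact: ulimr_cvg.
by rewrite /rnorm ucls_norm ulimE sc_injK.
Qed.

Lemma rnorm_ucls_le (x : linf E I) (M : R) :
  (forall i, rnorm (x i) <= M) -> rnorm (cls x) <= M.
Proof. by move=> xM; apply: (cvgr_to_le (@rnorm_ucls x)); exact: nearW. Qed.

Lemma uclsB (x y : linf E I) : cls (x - y) = cls x - cls y.
Proof. by rewrite uclsD -scaleN1r uclsZ scaleN1r. Qed.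

Lemma dual_ultrapower (f : I -> dual E) (M : R) :
  0 <= M -> (forall i, rnorm (f i) <= M) ->
  exists2 g : dual EU, rnorm g <= M &
    forall x : linf E I, rpart (f i) (x i) @[i --> U] --> rpart g (cls x).
Proof.
move=> M0 fM.
have f_le i x : `|rpart (f i) x| <= M * rnorm x.
  by rewrite (le_trans (rpart_le _ _))// ler_wpM2r// rnorm_ge0.
have /choice [l lP] : forall x : linf E I,
    exists l : R, rpart (f i) (x i) @[i --> U] --> l.
  move=> x; have [B xB] := linf_rbounded x.
  apply: (@ultra_cvg _ _ _ _ _ (M * B)); apply: nearW => i.
  by rewrite (le_trans (f_le _ _))// ler_wpM2l.
have lE (x : linf E I) (a : R) : rpart (f i) (x i) @[i --> U] --> a -> l x = a.
  by move=> xa; exact: (cvg_unique (@norm_hausdorff _ R^o) (lP x) xa).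
have lD x y : l (x + y) = l x + l y.
  apply: lE; apply: cvg_ext (cvgD (FF := _) (lP x) (lP y)) => i /=.
  by rewrite -(rpart_linear _).1.
have lZ r x : l (sc r *: x) = r * l x.
  apply: lE.
  apply: cvg_ext (cvgM (FF := _) (cvg_cst (FF := _) r) (lP x)) => i /=.
  by rewrite -(rpart_linear _).2.
have l_le x : l x <= M * rnorm (cls x).
  apply: (cvgr_le_to (lP x) (cvgM (cvg_cst M) (@rnorm_ucls x))) => i /=.
  exact: le_trans (ler_norm _) (f_le _ _).
(* Two representatives differ by a family of class 0, on which the norm bound makes [l] vanish. *)
have lrepr x : l (urepr (cls x)) = l x.
  have l0 y : l (- y) = - l y.
    by rewrite -scaleN1r -(sc_inj1 R k) -sc_injN lZ mulN1r.
  have := l_le (urepr (cls x) - x); have := l_le (x - urepr (cls x)).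
  by rewrite !uclsB ureprK subrr rnorm0 !lD !l0; lra.
have llin : rlinear (fun p : EU => l (urepr p)).
  split => [p q|r p].
    by rewrite -[p in LHS]ureprK -[q in LHS]ureprK -uclsD lrepr lD.
  by rewrite -[p in LHS]ureprK -uclsZ lrepr lZ.
have [|g gM gl] := dual_of_real M0 llin.
  by move=> p; rewrite (le_trans (l_le _))// ureprK.
by exists g => // x; rewrite gl lrepr.
Qed.

End UltrapowerNorm.

Section NonJConvex.
Variables (R : realType) (k : scalar_kind).
Local Notation K := (scalar_field R k).
Local Notation sc := (@sc_inj R k).
Variable E : normedModType K.
Hypothesis nJ : ~ J_convex E.

Let z (m : nat) : nat -> E := projT1 (cid (not_J_convex nJ m)).
Let f (m : nat) : nat -> dual E :=
  projT1 (cid (projT2 (cid (not_J_convex nJ m)))).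
Let zfP m := projT2 (cid (projT2 (cid (not_J_convex nJ m)))).

Let z1 m i : rnorm (z m i) <= 1.
Proof. by have [+ _ _ _] := zfP m; apply. Qed.

Let f1 m j : rnorm (f m j) <= 1.
Proof. by have [_ + _ _] := zfP m; apply. Qed.

Let fz_neg m i j : (i <= j < m)%N -> rpart (f m j) (z m i) <= - 2^-1.
Proof. by have [_ _ + _] := zfP m; apply. Qed.

Let fz_pos m i j : (j < i < m)%N -> 2^-1 <= rpart (f m j) (z m i).
Proof. by have [_ _ _ +] := zfP m; apply. Qed.

Variables (W : set_system nat) (UW : UltraFilter W).
Hypothesis W_free : \oo `<=` W.

Let near_gt (n : nat) : \forall m \near W, (n < m)%N.
Proof. by apply: W_free; exact: nbhs_infty_gt. Qed.

(** Under reflexivity a weak limit [y] of the [x i] and a weak-star limit [G] of the [g j] make both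
    iterated limits of [g j (x i)] equal to [G y]; one is at most -1/2 and the other at least
    1/2. *)
Lemma not_J_convex_not_reflexive : ~ reflexive_space (ultrapower E UW).
Proof.
move=> refl.
pose x i := ucls UW (linf_of (fun m => z1 m i)).
have x1 i : rnorm (x i) <= 1 by apply: rnorm_ucls_le => m; exact: z1.
have /choice [g gP] : forall j, exists g : dual (ultrapower E UW),
    rnorm g <= 1 /\ forall y : linf E nat,
      rpart (f m j) (y m) @[m --> W] --> rpart g (ucls UW y).
  move=> j; have [g g1 gf] := dual_ultrapower UW ler01 (fun m => f1 m j).
  by exists g.
have g1 j : rnorm (g j) <= 1 by exact: (gP j).1.
have gx_neg i j : (i <= j)%N -> rpart (g j) (x i) <= - 2^-1.
  move=> ij; apply: (cvgr_to_le ((gP j).2 _)).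
  by apply: filterS (near_gt j) => m jm; apply: fz_neg; rewrite ij.
have gx_pos i j : (j < i)%N -> 2^-1 <= rpart (g j) (x i).
  move=> ij; apply: (cvgr_to_ge ((gP j).2 _)).
  by apply: filterS (near_gt i) => m jm; apply: fz_pos; rewrite ij.
have ex1 i : rnorm (to_bidual (x i)) <= 1 by rewrite rnorm_to_bidual.
have [Phi _ PhiP] := dual_cvg (U := W) ler01 ex1.
have [G _ GP] := dual_cvg (U := W) ler01 g1.
have [y yPhi] := refl Phi; rewrite -yPhi in PhiP.
have : rpart G y <= - 2^-1.
  apply: (cvgr_to_le (PhiP G)); apply: nearW => i.
  apply: (cvgr_to_le (GP (x i))); apply: filterS (near_gt i) => j ij.
  exact/gx_neg/ltnW.
have : 2^-1 <= rpart G y.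
  apply: (cvgr_to_ge (GP y)); apply: nearW => j.
  apply: (cvgr_to_ge (PhiP (g j))); apply: filterS (near_gt j) => i ij.
  exact: gx_pos.
lra.
Qed.

(** * Rank-one operators and the failure of Arens regularity *)

Lemma rank1_linear (x : E) (h : dual E) : linear (fun y => evalb y h *: x).
Proof. by move=> a y y'; rewrite /evalb linearP scalerDl scalerA. Qed.

Lemma rank1_bounded (x : E) (h : dual E) y :
  `|evalb y h *: x| <= `|h| * `|x| * `|y|.
Proof. by rewrite normrZ mulrAC ler_wpM2r//; exact: bop_ub. Qed.

Lemma rank1_approximable (x : E) (h : dual E) :
  approximable (mk_bop (rank1_linear x h) (rank1_bounded x h)).
Proof.
apply/approximableP => e e0.
exists (mk_bop (rank1_linear x h) (rank1_bounded x h)).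
  exists 1%N, (fun=> x) => y; exists (fun=> evalb y h).
  by rewrite big_ord1.
by rewrite subrr normr0.
Qed.

Definition rank1 (x : E) (h : dual E) : approx_alg E :=
  ApproxOp (rank1_approximable x h).

Lemma rank1_norm (x : E) (h : dual E) : rnorm (rank1 x h) <= rnorm h * rnorm x.
Proof.
rewrite rnorm_le sc_injM !rnormK.
by apply: (bop_le (mulr_ge0 (normr_ge0 _) (normr_ge0 _))); exact: rank1_bounded.
Qed.

Definition apply_at (x : E) (h : dual E) (S : approx_alg E) : K^o :=
  evalb ((approx_bop S : bop E E) x) h.

Lemma apply_at_linear x h : linear (apply_at x h).
Proof. by move=> a S S'; rewrite /apply_at /evalb linearP. Qed.

Lemma apply_at_bounded x h S : `|apply_at x h S| <= `|h| * `|x| * `|S|.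
Proof.
rewrite (le_trans (bop_ub _ _))// -mulrA ler_wpM2l// mulrC.
exact: (bop_ub (approx_bop S)).
Qed.

Definition applyd x h : dual (approx_alg E) :=
  mk_bop (apply_at_linear x h) (apply_at_bounded x h).

(** The functional [F] is the ultralimit of [S -> h1 (S x0)]. As [h1 x0 = 1], it sends [a j ** b i]
    to the limit of [f m j (z m i)], and the two Arens products evaluate its two iterated limits. *)
Lemma not_J_convex_not_arens_regular :
  ~ arens_regular (ultrapower_alg (approx_alg E) UW).
Proof.
set AU := ultrapower_alg _ _ => areg.
(* The pattern of length 1 supplies a vector and a functional that does not vanish on it. *)
pose x0 := z 1%N 0%N; pose h0 := f 1%N 0%N.
have h00 : evalb x0 h0 != 0.
  apply/eqP => h0x0; have := @fz_neg 1%N 0%N 0%N isT.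
  rewrite /rpart -/x0 -/h0 h0x0 -(sc_inj0 R k) sc_injK; lra.
have [h1 h1x0] : exists h : dual E, (h : bop E K^o) x0 = 1.
  by exists ((evalb x0 h0)^-1 *: h0); exact: mulVf.
have a_le j m : rnorm (rank1 x0 (f m j)) <= 1.
  by rewrite (le_trans (rank1_norm _ _))// mulr_ile1 ?rnorm_ge0 ?f1 ?z1.
have b_le i m : rnorm (rank1 (z m i) h1) <= rnorm h1.
  by rewrite (le_trans (rank1_norm _ _))// ler_piMr ?rnorm_ge0 ?z1.
pose a j : AU := ucls UW (linf_of (a_le j)).
pose b i : AU := ucls UW (linf_of (b_le i)).
have [F _ FP] :=
  dual_ultrapower UW (rnorm_ge0 (applyd x0 h1)) (fun m => lexx _).
have ab j i :
    rpart (f m j) (z m i) @[m --> W] --> rpart F (nalg_mul (a j) (b i)).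
  rewrite [nalg_mul _ _]umulE; apply: cvg_ext (FP _) => m.
  rewrite /rpart; congr sc_re; rewrite /evalb /= /apply_at /= /bcompf /= /evalb.
  by rewrite h1x0 scale1r linearZ /= h1x0 [LHS]mulr1.
have F_neg i j : (i <= j)%N -> rpart F (nalg_mul (a j) (b i)) <= - 2^-1.
  move=> ij; apply: (cvgr_to_le (ab j i)).
  by apply: filterS (near_gt j) => m jm; apply: fz_neg; rewrite ij.
have F_pos i j : (j < i)%N -> 2^-1 <= rpart F (nalg_mul (a j) (b i)).
  move=> ij; apply: (cvgr_to_ge (ab j i)).
  by apply: filterS (near_gt i) => m jm; apply: fz_pos; rewrite ij.
have ea1 j : rnorm (to_bidual (a j)) <= 1.
  by rewrite rnorm_to_bidual; apply: rnorm_ucls_le => m; exact: a_le.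
have eb1 i : rnorm (to_bidual (b i)) <= rnorm h1.
  by rewrite rnorm_to_bidual; apply: rnorm_ucls_le => m; exact: b_le.
have [Phi _ PhiP] := dual_cvg (U := W) ler01 ea1.
have [Psi _ PsiP] := dual_cvg (U := W) (rnorm_ge0 h1) eb1.
have : rpart (arens1 Phi Psi) F = rpart (arens2 Phi Psi) F by rewrite areg.
have : 2^-1 <= rpart (arens1 Phi Psi) F.
  rewrite [leRHS](_ : _ = rpart Phi (bilmod (A := AU) Psi F))//.
  apply: (cvgr_to_ge (PhiP (bilmod (A := AU) Psi F))); apply: nearW => j.
  rewrite [leRHS](_ : _ = rpart Psi (rmod (A := AU) F (a j)))//.
  apply: (cvgr_to_ge (PsiP (rmod (A := AU) F (a j)))).
  apply: filterS (near_gt j) => i ij.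
  exact: F_pos.
have : rpart (arens2 Phi Psi) F <= - 2^-1.
  rewrite [leLHS](_ : _ = rpart Psi (birmod (A := AU) F Phi))//.
  apply: (cvgr_to_le (PsiP (birmod (A := AU) F Phi))); apply: nearW => i.
  rewrite [leLHS](_ : _ = rpart Phi (lmod (A := AU) (b i) F))//.
  apply: (cvgr_to_le (PhiP (lmod (A := AU) (b i) F))).
  apply: filterS (near_gt i) => j ij.
  exact/F_neg/ltnW.
lra.
Qed.

End NonJConvex.

(** * J-convex spaces are super-reflexive *)

Section Lifting.
Variables (R : realType) (k : scalar_kind).
Local Notation K := (scalar_field R k).
Local Notation sc := (@sc_inj R k).
Variables (E : normedModType K) (I : Type) (U : set_system I).
Variable UU : UltraFilter U.
Local Notation EU := (@ultrapower R k E I U UU).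
Local Notation cls := (@ucls R k E I U UU).

Lemma ucls_near (x y : linf E I) :
  (\forall i \near U, x i = y i) -> cls x = cls y.
Proof.
move=> xy; apply/ucls_eq; apply: cvg_near_cst.
apply: filterS xy => i xyi.
by rewrite [X in `|X|](_ : _ = x i - y i)// xyi subrr normr0.
Qed.

(** Replacing the entries of norm above [M] by 0 alters a representative only outside a set of [U],
    because [rnorm p < M] is strict. *)
Lemma bounded_lift (p : EU) (M : R) : rnorm p < M ->
  exists2 x : linf E I, cls x = p & forall i, rnorm (x i) <= M.
Proof.
move=> pM; pose r := urepr p.
pose x i := if rnorm (r i) <= M then r i else 0.
have xM i : rnorm (x i) <= M.
  rewrite /x; case: ifP => // _.
  by rewrite rnorm0 (le_trans (rnorm_ge0 p))// ltW.
exists (linf_of xM) => //; rewrite -[RHS](ureprK p); apply: ucls_near.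
have := @rnorm_ucls _ _ E I U UU r; rewrite ureprK => /cvgr_lt /(_ _ pM).
by apply: filterS => i /= /ltW rM; rewrite /x rM.
Qed.

End Lifting.

(** * Completeness of the ultrapower and closed range of its canonical embedding *)

Section Completeness.
Variables (R : realType) (k : scalar_kind).
Local Notation K := (scalar_field R k).
Local Notation sc := (@sc_inj R k).

Lemma geometric_small (a e : R) :
  0 <= a -> 0 < e -> exists n, a * 2^-1 ^+ n < e.
Proof.
move=> a0 e0; have := @cvg_geometric R a 2^-1.
rewrite ger0_norm// => /(_ ltac:(lra)) /cvgrPdist_lt /(_ e e0).
move=> [n _ /(_ n (leqnn n))].
rewrite /= sub0r normrN ger0_norm; last by rewrite mulr_ge0// exprn_ge0.
by exists n.
Qed.

Lemma rnorm_geometric (V : normedModType K) (s : nat -> V) :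
  (forall n, rnorm (s n.+1 - s n) <= 2^-1 ^+ n) ->
  forall n i, rnorm (s (n + i)%N - s n) <= 2 * 2^-1 ^+ n.
Proof.
move=> sC n i.
suff H : rnorm (s (n + i)%N - s n) <= 2 * 2^-1 ^+ n - 2 * 2^-1 ^+ (n + i).
  by apply: (le_trans H); rewrite gerBl mulr_ge0// exprn_ge0.
elim: i => [|i IHi]; first by rewrite addn0 !subrr rnorm0.
rewrite addnS -(subrK (s (n + i)%N) (s (n + i).+1)) -addrA.
rewrite (le_trans (rnormD _ _))//; have := sC (n + i)%N.
by rewrite exprS; lra.
Qed.

Lemma geometric_limit (E : completeNormedModType K) (s : nat -> E) :
  (forall n, rnorm (s n.+1 - s n) <= 2^-1 ^+ n) ->
  exists l : E, forall n, rnorm (l - s n) <= 2 * 2^-1 ^+ n.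
Proof.
move=> /rnorm_geometric sC.
have sc_lim : cvg (s @ \oo).
  apply: cauchy_cvg; apply: cauchy_exP => e e0.
  have [|n ne] := @geometric_small 2 (sc_re e) (ler0n _ 2).
    by rewrite -(@sc_inj_lt R k) sc_inj0 sc_reK// ltW.
  exists (s n), n => // i /= ni.
  rewrite -ball_normE /= -(sc_reK (ltW e0)) -rnorm_lt rnormB.
  by rewrite (le_lt_trans _ ne)// -(subnKC ni).
exists (lim (s @ \oo)) => n; apply/ler_addgt0Pr => e e0.
have e0' : 0 < sc e by rewrite -(sc_inj0 R k) sc_inj_lt.
have /cvgrPdist_lt /(_ _ e0') [i _ /(_ (n + i)%N (leq_addl _ _))] := sc_lim.
rewrite /= -rnorm_lt => li.
rewrite -(subrK (s (n + i)%N) (lim _)) -addrA (le_trans (rnormD _ _))//.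
by rewrite [leRHS]addrC lerD ?sC// ltW.
Qed.

Variables (E : completeNormedModType K) (I : Type) (U : set_system I).
Variable UU : UltraFilter U.
Local Notation EU := (@ultrapower R k E I U UU).
Local Notation cls := (@ucls R k E I U UU).

(** The increments lift to families with uniform geometric bounds, so the partial sums converge in
    every coordinate at a common rate. *)
Lemma ultrapower_complete (y : nat -> EU) :
  (forall n, rnorm (y n.+1 - y n) < 2^-1 ^+ n) ->
  exists w : EU, forall n, rnorm (w - y n) <= 2 * 2^-1 ^+ n.
Proof.
move=> yC.
have /choice [d dP] : forall n, exists d : linf E I, cls d = y n.+1 - y n /\
    forall i, rnorm (d i) <= 2^-1 ^+ n.
  by move=> n; have [d dy dn] := bounded_lift (yC n); exists d.
pose s n : linf E I := urepr (y 0%N) + \sum_(j < n) d j.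
have sS n : s n.+1 = s n + d n by rewrite /s big_ord_recr addrA.
have sy n : cls (s n) = y n.
  elim: n => [|n IHn]; first by rewrite /s big_ord0 addr0 ureprK.
  by rewrite sS uclsD IHn (dP n).1 addrC subrK.
have /choice [l lP] : forall i, exists l : E,
    forall n, rnorm (l - s n i) <= 2 * 2^-1 ^+ n.
  move=> i; apply: geometric_limit => n.
  by rewrite sS [X in rnorm X](_ : _ = d n i) ?(dP n).2// addrC addKr.
have [M sM] := linf_rbounded (s 0%N).
have lM i : rnorm (l i) <= 2 + M.
  rewrite -(subrK (s 0%N i) (l i)) (le_trans (rnormD _ _))// lerD//.
  by have := lP i 0%N; rewrite expr0 mulr1.
exists (cls (linf_of lM)) => n; rewrite -(sy n) -uclsB.
by apply: rnorm_ucls_le => i; exact: lP.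
Qed.

Lemma to_bidualB (V : normedModType K) (x y : V) :
  to_bidual (x - y) = to_bidual x - to_bidual y.
Proof. by apply: bopP => g; exact: (linearB (g : bop _ _)). Qed.

Lemma to_bidualD (V : normedModType K) (x y : V) :
  to_bidual (x + y) = to_bidual x + to_bidual y.
Proof. by apply: bopP => g; exact: (linearD (g : bop _ _)). Qed.

Lemma to_bidualZ (V : normedModType K) a (x : V) :
  to_bidual (a *: x) = a *: to_bidual x.
Proof. by apply: bopP => g; exact: (linearZ_LR (g : bop _ _)). Qed.

(** The range of the isometry [to_bidual] is closed, so an element outside it has positive distance
    to it. *)
Lemma bidual_dist (Psi : dual (dual EU)) :
  (forall e : R, 0 < e -> exists x, rnorm (Psi - to_bidual x) < e) ->
  exists x, to_bidual x = Psi.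
Proof.
move=> Psi_lim.
have /choice [y yP] : forall n : nat, exists x : EU,
    rnorm (Psi - to_bidual x) < 2^-1 ^+ n / 2.
  by move=> n; apply: Psi_lim; rewrite divr_gt0// exprn_gt0.
have [n|w wP] := @ultrapower_complete y.
  rewrite -rnorm_to_bidual to_bidualB -(subrKA Psi).
  rewrite (le_lt_trans (rnormD _ _))// rnormB.
  have := yP n; have := yP n.+1; have : 0 < 2^-1 ^+ n :> R by rewrite exprn_gt0.
  by rewrite exprS; lra.
exists w; apply/eqP; rewrite -subr_eq0; apply/eqP/rnorm0_eq0/le_anti.
rewrite rnorm_ge0 andbT; apply/ler_addgt0Pr => e e0; rewrite add0r.
have [n /ltW] := geometric_small (ler0n _ 3) e0; apply: le_trans.
rewrite -(subrKA (to_bidual (y n))) -to_bidualB (le_trans (rnormD _ _))//.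
rewrite rnorm_to_bidual [X in _ + X]rnormB.
have := wP n; have := yP n; have : 0 < 2^-1 ^+ n :> R by rewrite exprn_gt0.
by lra.
Qed.

End Completeness.

Lemma linf_sumE (K : numFieldType) (V : normedModType K) (I J : Type)
    (r : seq J) (x : J -> linf V I) i :
  (\sum_(j <- r) x j) i = \sum_(j <- r) x j i.
Proof. by elim/big_rec2 : _ => // j y z _ <-. Qed.

Section JConvexReflexive.
Variables (R : realType) (k : scalar_kind).
Local Notation K := (scalar_field R k).
Local Notation sc := (@sc_inj R k).

Lemma cvg_sum_real (I J : Type) (F : set_system I) {FF : Filter F} (r : seq J)
    (u : J -> I -> R) (l : J -> R) : (forall j, u j i @[i --> F] --> l j) ->
  \sum_(j <- r) u j i @[i --> F] --> \sum_(j <- r) l j.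
Proof. by move=> ul; apply: cvg_big => //; exact: add_continuous. Qed.

Lemma near_points (V : normedModType K) (G : dual V -> R) (M : R)
    (F : seq (dual V)) (e : R) :
  rlinear G -> 0 <= M -> (forall f, G f <= M * rnorm f) -> 0 < e ->
  exists2 v : V, rnorm v < M + 1 & {in F, forall f, `|rpart f v - G f| < e}.
Proof.
move=> Gl M0 GM e0; have M1 : M < M + 1 by rewrite ltrDl.
have [v vM vF] := goldstine Gl GM M0 M1 (fun j : 'I_(size F) => nth 0 F j) e0.
exists v => // f /(nthP 0) [j jF <-]; exact: (vF (Ordinal jF)).
Qed.

Variables (E : completeNormedModType K) (I : Type) (U : set_system I).
Variable UU : UltraFilter U.
Local Notation EU := (@ultrapower R k E I U UU).
Local Notation cls := (@ucls R k E I U UU).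

Lemma jsum_ucls (m : nat) (x : 'I_m -> linf E I) j :
  jsum (fun i => cls (x i)) j = cls (jsum x j).
Proof.
have clsN y : cls (- y) = - cls y by rewrite -scaleN1r uclsZ scaleN1r.
have cls0 : cls 0 = 0 by rewrite -(scale0r 0) uclsZ scale0r.
rewrite /jsum (big_morph cls (@uclsD _ _ _ _ _ UU) cls0).
by apply: eq_bigr => i _; case: ifP.
Qed.

Lemma jsum_linf (m : nat) (x : 'I_m -> linf E I) j i :
  jsum x j i = jsum (fun l => x l i) j.
Proof. by rewrite /jsum linf_sumE; apply: eq_bigr => l _; case: ifP. Qed.

Lemma quadratic_ultrapower (m : nat) (c : R) :
  (forall z : 'I_m -> E,
    \sum_(j < m) rnorm (jsum z j) ^+ 2 <=
    c * m%:R ^+ 2 * \sum_(i < m) rnorm (z i) ^+ 2) ->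
  forall z : 'I_m -> EU,
    \sum_(j < m) rnorm (jsum z j) ^+ 2 <=
    c * m%:R ^+ 2 * \sum_(i < m) rnorm (z i) ^+ 2.
Proof.
move=> Ec z.
have -> : z = fun i => cls (urepr (z i)) by apply/funext => i; rewrite ureprK.
pose x i := urepr (z i); rewrite -/(x _).
have sq (y : linf E I) : rnorm (y i) ^+ 2 @[i --> U] --> rnorm (cls y) ^+ 2.
  by apply: cvgM; exact: rnorm_ucls.
under eq_bigr do rewrite jsum_ucls.
apply: (cvgr_le_to (cvg_sum_real (fun j : 'I_m => @sq (jsum x j)))
  (cvgM (cvg_cst (c * m%:R ^+ 2))
    (cvg_sum_real (fun i : 'I_m => @sq (x i))))) => i /=.
by under eq_bigr do rewrite jsum_linf; exact: Ec.
Qed.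

(** For [Psi] off the range, Hahn-Banach gives [G] that vanishes on the range with [G Psi > 0]. By
    Goldstine, [G] is a limit of evaluations at functionals [f]: then [f x] tends to 0 for each [x]
    while [Psi f] tends to [G Psi], a gap that James' argument excludes. *)
Lemma J_convex_reflexive : J_convex E -> reflexive_space EU.
Proof.
move=> /J_convex_quadratic [m [c [m0 c01 /quadratic_ultrapower quadr]]] Psi.
apply: bidual_dist => e e0; apply: contrapT => Psi_far.
pose F (x : EU) (Xi : dual (dual EU)) := rnorm (Xi - to_bidual x).
have FD x y Xi Xi' : exists w, F w (Xi + Xi') <= F x Xi + F y Xi'.
  exists (x + y); rewrite /F to_bidualD opprD addrACA; exact: rnormD.
have FZ x (r : R) Xi : 0 < r -> exists w, F w (sc r *: Xi) <= r * F x Xi.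
  move=> r0; exists (sc r *: x).
  by rewrite /F to_bidualZ -scalerBr rnormZ gtr0_norm.
have F0 x : 0 <= F x 0 by exact: rnorm_ge0.
have [G [Glin GF GPsi]] := hahn_banach Psi (infF_sublinear (0 : EU) FD FZ F0).
have G_le Xi : G Xi <= 1 * rnorm Xi.
  rewrite mul1r (le_trans (GF Xi))// (le_trans (infF_le (0 : EU) FD F0 0 Xi))//.
  by rewrite /F -[in to_bidual _](subrr 0) to_bidualB subrr subr0.
have G_le0 x : G (to_bidual x) <= 0.
  rewrite (le_trans (GF _))// (le_trans (infF_le (0 : EU) FD F0 x _))//.
  by rewrite /F subrr rnorm0.
have Gev x : G (to_bidual x) = 0.
  apply/le_anti; rewrite G_le0 /= -oppr_le0 -(rlinearN _ Glin).
  by rewrite -scaleN1r -to_bidualZ.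
have GPsi_gt0 : 0 < G Psi.
  rewrite GPsi (lt_le_trans e0)//; apply: (infF_ge (0 : EU) FD F0) => x.
  by rewrite leNgt; apply/negP => H; apply: Psi_far; exists x.
have [W [UW W2 Wlim]] := goldstine_ultra Glin G_le ler01 (ltr1n R 2).
apply: (@james_contradiction _ _ EU (dual EU) W UW 0 (fun f x => rpart f x)
  (rpart Psi) (fun=> 0) (G Psi) 0 (fun x => rnorm x ^+ 2) (@rnorm _ _ _) m c
  (rnorm Psi + 1) 1 (1 / 4)) => //.
- exact: rpart_linear.
- by move=> x; have := Wlim (to_bidual x); rewrite Gev.
- move=> F' e' e'0; have Psi_le f : rpart Psi f <= rnorm Psi * rnorm f.
    exact: le_trans (ler_norm _) (rpart_le _ _).
  have [b bC bF] :=
    near_points F' (rpart_linear Psi) (rnorm_ge0 Psi) Psi_le e'0.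
  exists b; split; first exact: ltW.
    by move=> f /bF /ltW.
  by rewrite subrr normr0 ltW.
- exact: rnormD.
- exact: rnormN.
- by move=> r x r0; rewrite rnormZ ger0_norm.
- exact: rnorm_ge0.
- by move=> x; rewrite mul1r.
- have qZ (r : R) (x : EU) : rnorm (sc r *: x) ^+ 2 = r ^+ 2 * rnorm x ^+ 2.
    by rewrite rnormZ exprMn real_normK// num_real.
  have /andP[c0 _] := c01.
  exact: (quadratic_jsum m0 c0 qZ quadr).
(* Since [rnorm f < 2], a value of at least 1 forces [rnorm x >= 1/2], whence the constant 1/4. *)
- apply: filterS W2 => f f2 x fx.
  have fx2 : 1 <= rnorm f * rnorm x.
    by rewrite (le_trans fx)// (le_trans (ler_norm _))// rpart_le.
  have := rnorm_ge0 x; have := rnorm_ge0 f; move: f2 fx2 => /= f2 fx2.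
  have : rnorm f * rnorm x <= 2 * rnorm x by rewrite ler_wpM2r ?rnorm_ge0 ?ltW.
  nra.
Qed.

End JConvexReflexive.

(** * J-convexity implies super Arens regularity *)

Section Domination.
Variables (R : realType) (k : scalar_kind).
Local Notation K := (scalar_field R k).
Local Notation sc := (@sc_inj R k).

Lemma linf_has_sup (L : Type) (w0 : L) (g : linf R^o L) :
  has_sup (range (g : L -> R)).
Proof.
split; first by exists (g w0), w0.
have [M gM] := linfP g; exists M => _ [w _ <-].
exact: le_trans (ler_norm _) (gM w).
Qed.

(** [Lam] is a linear functional below the infimum over [x] of [C sup (g + nu x) - u x]. Taking
    [x = 0] shows that it is positive, and [g = - nu x] gives the domination of [u]. *)
Lemma positive_domination (L : Type) (w0 : L) (X : lmodType K)
    (nu : X -> linf R^o L) (u : X -> R) (C : R) :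
  rlinear u -> 0 <= C ->
  (forall x y w, nu (x + y) w <= nu x w + nu y w) ->
  (forall (r : R) x w, 0 < r -> nu (sc r *: x) w = r * nu x w) ->
  (forall x s, (forall w, nu x w <= s) -> u x <= C * s) ->
  exists Lam : linf R^o L -> R, [/\ forall g h, Lam (g + h) = Lam g + Lam h,
    forall (r : R) g, Lam (r *: g) = r * Lam g,
    forall g : linf R^o L, (forall w, 0 <= g w) -> 0 <= Lam g &
    forall x, u x <= Lam (nu x)].
Proof.
move=> ul C0 nuD nuZ uC.
pose S (g : linf R^o L) : R := sup (range (g : L -> R)).
have S_ub (g : linf R^o L) w : g w <= S g.
  by apply: ub_le_sup; [exact: (linf_has_sup w0 g).2|exists w].
have S_le (g : linf R^o L) s : (forall w, g w <= s) -> S g <= s.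
  by move=> gs; apply: ge_sup; [exact: (linf_has_sup w0 g).1|move=> _ [w _ <-]].
pose V : lmodType (scalar_field R RealScalars) := linf R^o L.
pose F (x : X) (g : V) : R := C * S (g + nu x) - u x.
have S_ubD (g : V) x w : (g : linf R^o L) w + nu x w <= S (g + nu x).
  exact: (S_ub (g + nu x) w).
have FD x y (g h : V) : exists z, F z (g + h) <= F x g + F y h.
  exists (x + y); rewrite /F ul.1 opprD addrACA lerD2r -mulrDr ler_wpM2l//.
  apply: S_le => w; have := S_ubD g x w; have := S_ubD h y w; have := nuD x y w.
  rewrite [X in _ -> _ -> _ -> X <= _](_ : _ =
    (g : linf R^o L) w + (h : linf R^o L) w + nu (x + y) w)//.
  lra.
have FZ x (r : R) (g : V) : 0 < r ->
    exists z, F z (@sc_inj R RealScalars r *: g) <= r * F x g.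
  move=> r0; exists (sc r *: x).
  rewrite /F ul.2 mulrBr lerD2r mulrCA ler_wpM2l//.
  apply: S_le => w; have := S_ubD g x w.
  rewrite -(ler_pM2l r0) mulrDr.
  apply: le_trans.
  by rewrite -[(_ + _ : linf R^o L) w]/(r * g w + nu (sc r *: x) w) nuZ.
have nu0 w : nu 0 w = 0.
  by have := nuZ 2 0 w (ltr0n _ 2); rewrite scaler0; lra.
have F0 x : 0 <= F x 0.
  by rewrite subr_ge0; apply: uC => w; rewrite add0r; exact: S_ub.
have [Lam Laml LamF] :=
  minimal_sublinear (@infF_sublinear R RealScalars V X 0 F FD FZ F0).
have Lam_le x g : Lam g <= F x g.
  exact: le_trans (LamF g) (@infF_le R RealScalars V X 0 F FD F0 x g).
exists Lam; split; [exact: Laml.1|exact: Laml.2|move=> g g0|move=> x].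
  rewrite -oppr_le0 -(rlinearN _ Laml) (le_trans (Lam_le 0 _))//.
  rewrite /F (rlinear0 ul) subr0 mulr_ge0_le0//; apply: S_le => w.
  by rewrite -[(_ + _ : linf R^o L) w]/(- g w + nu 0 w) nu0 addr0 oppr_le0.
rewrite -lerN2 -(rlinearN _ Laml) (le_trans (Lam_le x _))//.
rewrite /F addNr gerDr mulr_ge0_le0//; apply: S_le => w.
by rewrite [leLHS](_ : _ = 0).
Qed.

End Domination.

Section JConvexArens.
Variables (R : realType) (k : scalar_kind).
Local Notation K := (scalar_field R k).
Local Notation sc := (@sc_inj R k).

Lemma rnorm_bop_le (E : normedModType K) (T : bop E E) (s : R) :
  (forall x, rnorm x <= 1 -> rnorm (T x) <= s) -> rnorm T <= s.
Proof.
move=> Ts; rewrite /rnorm bop_normE /opnorm sc_injK; apply: ge_sup.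
  exact: (opnorm_has_sup T).1.
by move=> _ [x /= x1 <-]; apply: Ts; rewrite rnorm_le sc_inj1.
Qed.

(** * The sup norm on bounded families *)

Section SupNorm.
Variables (V : normedModType K) (I : Type) (i0 : I).
Implicit Types x y : linf V I.

Definition snorm (x : linf V I) : R := sup (range (fun i => rnorm (x i))).

Lemma snorm_has_sup x : has_sup (range (fun i => rnorm (x i))).
Proof.
split; first by exists (rnorm (x i0)), i0.
by have [M xM] := linf_rbounded x; exists M => _ [i _ <-].
Qed.

Lemma snorm_ub x i : rnorm (x i) <= snorm x.
Proof. by apply: ub_le_sup; [exact: (snorm_has_sup x).2|exists i]. Qed.

Lemma snorm_le x (M : R) : (forall i, rnorm (x i) <= M) -> snorm x <= M.
Proof.
by move=> xM; apply: ge_sup; [exact: (snorm_has_sup x).1|move=> _ [i _ <-]].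
Qed.

Lemma snorm_ge0 x : 0 <= snorm x.
Proof. exact: le_trans (rnorm_ge0 _) (snorm_ub x i0). Qed.

Lemma snormD x y : snorm (x + y) <= snorm x + snorm y.
Proof.
by apply: snorm_le => i; rewrite (le_trans (rnormD _ _))// lerD// snorm_ub.
Qed.

Lemma snormN x : snorm (- x) = snorm x.
Proof.
by congr sup; apply: eq_imagel => i _; exact: rnormN.
Qed.

Lemma snormZ (r : R) x : 0 <= r -> snorm (sc r *: x) = r * snorm x.
Proof.
have le (s : R) y : 0 <= s -> snorm (sc s *: y) <= s * snorm y.
  move=> s0; apply: snorm_le => i.
  by rewrite [leLHS]rnormZ ger0_norm// ler_wpM2l// snorm_ub.
rewrite le_eqVlt => /predU1P[<-|r0].
  by apply/le_anti; rewrite le//= mul0r snorm_ge0.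
apply/le_anti; rewrite (le r x (ltW r0)) /= -ler_pdivlMl//.
rewrite -[x in leLHS]scale1r -(sc_inj1 R k) -(mulVf (lt0r_neq0 r0)).
rewrite sc_injM -scalerA.
by apply: le; rewrite invr_ge0 ltW.
Qed.

End SupNorm.

Variables (E : normedModType K) (I : Type) (U : set_system I).
Variable UU : UltraFilter U.
Local Notation A := (approx_alg E).
Local Notation AU := (ultrapower_alg A UU).
Local Notation cls := (@ucls R k A I U UU).
Local Notation L := (I * {x : E | rnorm x <= 1})%type.

(** A family of operators becomes a function of an index and a vector of the unit ball; the supremum
    of its norm over [w] is the sup norm of the family. *)
Definition appl (b : linf A I) (w : L) : E := approx_bop (b w.1) (val w.2).

Lemma appl_le (b : linf A I) (w : L) (M : R) :
  (forall i, rnorm (b i) <= M) -> rnorm (appl b w) <= M.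
Proof.
move=> bM; apply: le_trans (bM w.1).
have H : rnorm (appl b w) <= rnorm (b w.1) * rnorm (val w.2).
  rewrite rnorm_le sc_injM !rnormK; exact: (bop_ub (approx_bop (b w.1))).
by rewrite (le_trans H)// ler_piMr ?rnorm_ge0//; exact: (valP w.2).
Qed.

Lemma applD (b b' : linf A I) (w : L) : appl (b + b') w = appl b w + appl b' w.
Proof. by rewrite /appl [(b + b') w.1](_ : _ = b w.1 + b' w.1). Qed.

Lemma applZ a (b : linf A I) (w : L) : appl (a *: b) w = a *: appl b w.
Proof. by rewrite /appl [(a *: b) w.1](_ : _ = a *: b w.1). Qed.

Lemma applN (b : linf A I) (w : L) : appl (- b) w = - appl b w.
Proof. by rewrite -scaleN1r applZ scaleN1r. Qed.

Lemma appl_jsum (m : nat) (b : 'I_m -> linf A I) j (w : L) :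
  appl (jsum b j) w = jsum (fun i => appl (b i) w) j.
Proof.
have appl0 : appl 0 w = 0 by [].
rewrite /jsum (big_morph (appl^~ w) (fun b b' => applD b b' w) appl0).
by apply: eq_bigr => i _; case: ifP => _; [exact: applN|].
Qed.

Lemma appl_rnorm_bounded (b : linf A I) :
  exists M : R, forall w, `|rnorm (appl b w)| <= M.
Proof.
have [M bM] := linf_rbounded b; exists M => w.
by rewrite ger0_norm ?rnorm_ge0// appl_le.
Qed.

Definition appl_norm (b : linf A I) : linf R^o L :=
  mk_linf (projT2 (cid (appl_rnorm_bounded b))).

Lemma appl_normE (b : linf A I) (w : L) : appl_norm b w = rnorm (appl b w).
Proof. by []. Qed.

Lemma appl_norm_sqr_bounded (b : linf A I) :
  exists M : R, forall w, `|rnorm (appl b w) ^+ 2| <= M.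
Proof.
have [M bM] := appl_rnorm_bounded b; exists (M ^+ 2) => w.
by rewrite normrX lerXn2r ?nnegrE// (le_trans _ (bM w)).
Qed.

Definition appl_sqr (b : linf A I) : linf R^o L :=
  mk_linf (projT2 (cid (appl_norm_sqr_bounded b))).

Lemma appl_sqrE (b : linf A I) (w : L) : appl_sqr b w = rnorm (appl b w) ^+ 2.
Proof. by []. Qed.

Let one : linf R^o L := mk_linf (fun w : L => lexx `|(1 : R)|).

(** Unequal Arens products at [f] are unequal iterated limits of [f (v b)], for [v] tending to [Phi]
    and [b] to [Psi]. James' argument runs on families [b] rather than on their classes, because [q]
    is defined on families. *)
Lemma J_convex_arens_regular : J_convex E -> arens_regular AU.
Proof.
move=> /J_convex_quadratic [m [c [m0 c01 quadr]]] Phi Psi.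
have [i0 _] : exists i : I, True.
  by have [i _] := filter_ex (filterT : U setT); exists i.
have w0 : L by split => //; exists 0; rewrite rnorm0.
suff no_gap (f : dual AU) :
    ~ rpart (arens2 Phi Psi) f < rpart (arens1 Phi Psi) f.
  apply: dual_eq => f; apply/eqP; apply: contrapT => /negP.
  rewrite neq_lt => /orP[lt12|/no_gap//]; apply: (no_gap (- f)).
  by rewrite !(rlinearN _ (rpart_linear _)) ltrN2.
move=> gap.
pose X := linf A I.
pose u (b : X) := rpart f (cls b).
have ul : rlinear u.
  split=> [x y|r x]; rewrite /u ?uclsD ?uclsZ.
    exact: (rpart_linear f).1.
  exact: (rpart_linear f).2.
have nuD (x y : X) w : appl_norm (x + y) w <= appl_norm x w + appl_norm y w.
  by rewrite !appl_normE applD rnormD.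
have nuZ (r : R) (x : X) w :
    0 < r -> appl_norm (sc r *: x) w = r * appl_norm x w.
  by move=> r0; rewrite !appl_normE applZ rnormZ gtr0_norm.
have uC (x : X) s : (forall w, appl_norm x w <= s) -> u x <= rnorm f * s.
  move=> xs; rewrite (le_trans (ler_norm _))// (le_trans (rpart_le _ _))//.
  rewrite ler_wpM2l ?rnorm_ge0//; apply: rnorm_ucls_le => i.
  apply: (@rnorm_bop_le _ (approx_bop (x i))) => y y1.
  exact: (xs (i, exist _ y y1)).
have [Lam [LamD LamZ Lam_ge0 uLam]] :=
  positive_domination w0 ul (rnorm_ge0 f) nuD nuZ uC.
have Lam_le (g h : linf R^o L) : (forall w, g w <= h w) -> Lam g <= Lam h.
  move=> gh; rewrite -subr_ge0 -mulN1r -LamZ -LamD; apply: Lam_ge0 => w.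
  by rewrite scaleN1r [leRHS](_ : _ = h w - g w)// subr_ge0.
have Lam_sum (J : Type) (r : seq J) (g : J -> linf R^o L) :
    Lam (\sum_(j <- r) g j) = \sum_(j <- r) Lam (g j).
  by apply: big_morph => //; rewrite -(scale0r 0) LamZ mul0r.
pose q (b : X) := Lam (appl_sqr b).
have qZ (r : R) (b : X) : q (sc r *: b) = r ^+ 2 * q b.
  rewrite -LamZ; congr Lam; apply: linf_eq => w.
  rewrite [RHS](_ : _ = r ^+ 2 * appl_sqr b w)// !appl_sqrE applZ rnormZ exprMn.
  by rewrite real_normK// num_real.
have q_quadr (b : 'I_m -> X) :
    \sum_(j < m) q (jsum b j) <= c * m%:R ^+ 2 * \sum_(i < m) q (b i).
  rewrite -!Lam_sum -LamZ; apply: Lam_le => w.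
  rewrite linf_sumE.
  rewrite [leRHS](_ : _ = c * m%:R ^+ 2 * (\sum_(i < m) appl_sqr (b i)) w)//.
  rewrite linf_sumE.
  under eq_bigr do rewrite appl_sqrE appl_jsum.
  by under [in leRHS]eq_bigr do rewrite appl_sqrE; exact: quadr.
have Lam1_ge0 : 0 <= Lam one by apply: Lam_ge0 => w; exact: ler01.
have q_snorm (b : X) : q b <= Lam one * snorm b ^+ 2.
  rewrite mulrC -LamZ; apply: Lam_le => w.
  rewrite [leRHS](_ : _ = snorm b ^+ 2 * 1)// mulr1 appl_sqrE.
  rewrite lerXn2r ?nnegrE ?rnorm_ge0 ?(snorm_ge0 i0)//.
  by apply: appl_le => i; exact: snorm_ub.
have Psi_le g : rpart Psi g <= rnorm Psi * rnorm g.
  exact: le_trans (ler_norm _) (rpart_le _ _).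
have Phi_le g : rpart Phi g <= rnorm Phi * rnorm g.
  exact: le_trans (ler_norm _) (rpart_le _ _).
pose N := rnorm Phi + 1.
have N0 : 0 < N by rewrite ltr_wpDl// rnorm_ge0.
have PhiN : rnorm Phi < N by rewrite ltrDl.
have [W [UW WN Wlim]] :=
  goldstine_ultra (rpart_linear Phi) Phi_le (rnorm_ge0 Phi) PhiN.
(* This choice gives [s * Lam one <= 1]; the added 1 covers the case [Lam one = 0]. *)
pose s : R := (Lam one + 1)^-1.
have s0 : 0 < s by rewrite invr_gt0 ltr_wpDl.
have c0 : 0 <= c by case/andP: c01.
apply: (@james_contradiction R k X AU W UW 0
  (fun v b => rpart (rmod f v) (cls b)) (rpart (bilmod Psi f))
  (fun b => rpart Phi (lmod (cls b : AU) f))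
  (rpart (arens1 Phi Psi) f) (rpart (arens2 Phi Psi) f)
  q (@snorm A I) m c (rnorm Psi + 1) (Lam one) (s / N ^+ 2)).
- move=> v; split=> [x y|r x]; rewrite ?uclsD ?uclsZ.
    exact: (rpart_linear _).1.
  exact: (rpart_linear _).2.
- exact: (Wlim (bilmod Psi f)).
- by move=> b; exact: (Wlim (lmod (cls b : AU) f)).
- exact: gap.
- move=> F e e0.
  (* The functional [birmod f Phi] joins the list because its value at the class of [b] is
     [Phi (b . f)], the limit in [v]. *)
  have [v vN vF] := near_points (birmod f Phi :: map (rmod f) F)
    (rpart_linear Psi) (rnorm_ge0 Psi) Psi_le e0.
  have [b bv bN] := bounded_lift vN; exists b; split.
  + by apply: snorm_le.
  + move=> t tF; rewrite bv; apply/ltW/(vF (rmod f t)).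
    by rewrite inE map_f ?orbT.
  + by rewrite bv; apply/ltW/(vF (birmod f Phi)); rewrite mem_head.
- exact: (snormD i0).
- exact: snormN.
- exact: (snormZ i0).
- exact: (snorm_ge0 i0).
- exact: q_snorm.
- exact: Lam1_ge0.
- exact: m0.
- exact: c01.
- exact: (quadratic_jsum m0 c0 qZ q_quadr).
- by rewrite divr_gt0// exprn_gt0.
(* If [Re f (v b) >= 1], then [Lam] of the norms of [a b] is at least 1. The first term of the bound
   [AMGM] is at most 1/2, so the second gives [q b >= s / N ^+ 2]. *)
apply: filterS WN => v vN b vb.
have [a av aN] := bounded_lift vN.
have : 1 <= Lam (appl_norm (lmul a b)).
  apply: le_trans (uLam _); rewrite /u -umulE av; exact: vb.
(* AM-GM: [2 s N g <= s^2 + N^2 g^2] *)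
have AMGM : Lam (appl_norm (lmul a b)) <=
    s / 2 * Lam one + N ^+ 2 / (2 * s) * q b.
  rewrite -!LamZ -LamD; apply: Lam_le => w.
  rewrite [leRHS](_ : _ =
    s / 2 * 1 + N ^+ 2 / (2 * s) * rnorm (appl b w) ^+ 2)//.
  apply: (@le_trans _ _ (N * rnorm (appl b w))).
    rewrite appl_normE.
    apply: (@le_trans _ _ (rnorm (a w.1) * rnorm (appl b w))).
      rewrite rnorm_le sc_injM !rnormK; exact: (bop_ub (approx_bop (a w.1))).
    by rewrite ler_wpM2r ?rnorm_ge0.
  rewrite -subr_ge0; set g := rnorm _.
  have -> : s / 2 * 1 + N ^+ 2 / (2 * s) * g ^+ 2 - N * g =
      (s - N * g) ^+ 2 / (2 * s).
    by field; rewrite gt_eqF.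
  by rewrite divr_ge0 ?sqr_ge0// mulr_ge0// ltW.
have sLam : s * Lam one <= 1 by rewrite ler_pdivrMl ?ltr_wpDl// mulr1 lerDl.
move=> /le_trans /(_ AMGM) le1.
rewrite ler_pdivrMr ?exprn_gt0// mulrC.
have : 1 / 2 <= N ^+ 2 / (2 * s) * q b by lra.
rewrite mulrAC ler_pdivlMr ?mulr_gt0//; lra.
Qed.

End JConvexArens.

Theorem proposition3p4 (R : realType) (k : scalar_kind)
    (E : completeNormedModType (scalar_field R k)) :
  super_arens_regular (approx_alg E) <-> super_reflexive E.
Proof.
(* One free ultrafilter on [nat] refutes both properties when [E] is not J-convex. *)
have [W WU W_free] := nat_ultrafilter.
split=> EP I U UU.
  apply: J_convex_reflexive; apply: contrapT => nJ.
  exact: (not_J_convex_not_arens_regular nJ W_free (EP _ _ WU)).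
apply: J_convex_arens_regular; apply: contrapT => nJ.
exact: (not_J_convex_not_reflexive nJ W_free (EP _ _ WU)).
Qed.
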